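(* Let $T$ be a complete first-order theory with distinguished unary predicate $P$ satisfying the standing assumptions in the context. Let $\lambda>|T|$ be a cardinal, let $N\models T^P$ be $\lambda$-compact, and assume that $T$ is fully stable over $N$. Then $T$ has the full $\lambda$-existence property over $N$. More specifically: let $A$ be a complete set with $P^A=N$. Then there exists a $\lambda$-saturated model $M\models T$ containing $A$ with $P^M=P^A$ and $|M|\le |A|^{|T|}+\mathrm{reg}(\lambda)$, where $\mathrm{reg}(\lambda)$ is the least regular cardinal $\ge\lambda$. Moreover, this $M$ can be taken to be $\lambda$-constructible over $A$ (hence $\lambda$-primary over $A$, i.e. both $\lambda$-constructible over $A$ and $\lambda$-saturated).
   Context: Setting. $T$ is a complete first-order theory in a language $L$ without function symbols, $P$ is a unary predicate of $L$, and $T$ implies that $P$ is infinite. $\mathcal C$ is a monster model of $T$; all models of $T$ are elementary submodels of $\mathcal C$ and all sets are subsets of $\mathcal C$ (as usual, small ones), regarded as substructures; $\mathcal C|_A$ is the substructure with universe $A$. $P^A=A\cap P^{\mathcal C}$, $\mathcal C^P=\mathcal C|_{P^{\mathcal C}}$, $T^P=\mathrm{Th}(\mathcal C^P)$; models of $T^P$ are taken to be elementary submodels of $\mathcal C^P$. Write $A\equiv B$ if $\mathrm{Th}(\mathcal C|_A)=\mathrm{Th}(\mathcal C|_B)$. Standing assumptions: (1) $P$ is stably embedded: subsets of (powers of) $P^{\mathcal C}$ definable in $\mathcal C$ with parameters are definable in $\mathcal C$ with parameters from $P^{\mathcal C}$; (2) subsets of (powers of) $P^{\mathcal C}$ that are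 $0$-definable in $\mathcal C$ are $0$-definable in $\mathcal C^P$; (3) $T$ has quantifier elimination, even down to predicates (every formula is equivalent modulo $T$ to a predicate of $L$). Definitions. A set $A$ is complete if for every formula $\psi(\bar x,\bar y)$ and $\bar b\subseteq A$, if $\models(\exists\bar x\subseteq P)\psi(\bar x,\bar b)$ then $\models\psi(\bar a,\bar b)$ for some $\bar a\subseteq P^A$. For $A$ complete, $S_*(A)=\{\mathrm{tp}(\bar c/A): P\cap(A\cup\bar c)=P\cap A$ and $A\cup\bar c$ is complete$\}$ ($\bar c$ finite tuples). A complete set $A$ is stable (over $P$) if $|S_*(A')|\le|A'|^{|T|}$ for all $A'\equiv A$. $T$ is fully stable over $N\models T^P$ if every complete set $A$ with $P^A=N$ is stable. A structure is $\lambda$-compact if every finitely satisfiable set of fewer than $\lambda$ formulas (in finitely many variables) with parameters in it is realized in it. $A$ has the $\lambda$-existence property if there is a $\lambda$-saturated $M\models T$ with $A\subseteq M$ and $P^M=P^A$; $T$ has full $\lambda$-existence over $N$ if every complete $A$ with $P^A=N$ has the $\lambda$-existence property. A type $p$ over a set $B$ is $\lambda$-isolated if there is $r\subseteq p$ with $|r|<\lambda$ and $r\equiv p$. A model $M$ with $P^M\subseteq A\subseteq M$ is $\lambda$-constructible over $A$ if one can write $M=A\cup\{d_i:i<\alpha\}$ for some ordinal $\alpha$ such that for all $i<\alpha$ the type $\mathrm{tp}(d_i/A\cup\{d_j:j<i\})$ is $\lambda$-isolated. *)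

(* Defs.v *)
From mathcomp Require Import all_boot.
From mathcomp Require Import boolp classical_sets functions cardinality wochoice.

Set Implicit Arguments.
Unset Strict Implicit.
Unset Printing Implicit Defensive.

Local Open Scope classical_set_scope.
Local Open Scope card_scope.

(** * Cardinals *)

(* A cardinal is represented by any type of that cardinality.  The name fixes
   one universe level for all of them, so that "least" in [is_reg] ranges over
   all the types that may represent a cardinal. *)
Definition cardinal := Type.

Definition card_lt T U (A : set T) (B : set U) : Prop :=
  A #<= B /\ ~ (B #<= A).
Notation "A '#<' B" := (card_lt A B) (at level 79) : card_scope.

Definition strong_limit (K : cardinal) : Prop :=
  forall X : set K, X #< [set: K] -> [set: set X] #< [set: K].

(* [K] is not a union of fewer than [K] sets of cardinality less than [K]. *)
Definition regular (K : cardinal) : Prop :=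
  infinite_set [set: K] /\
  forall (I : set K) (F : K -> set K),
    I #< [set: K] -> (forall i, I i -> F i #< [set: K]) ->
    \bigcup_(i in I) F i <> [set: K].

Definition is_reg (lam R : cardinal) : Prop :=
  [/\ regular R, [set: lam] #<= [set: R] &
      forall S : cardinal, regular S -> [set: lam] #<= [set: S] ->
        [set: R] #<= [set: S]].

(** * First-order logic without function symbols *)

Record language := Language { rel_symbol : nat -> Type }.

(* [formula L V]: formulas with free variables in [V]; [All] binds [None]. *)
#[universes(template=no)]
Inductive formula (L : language) (V : Type) : Type :=
| Rel n (R : rel_symbol L n) (t : n.-tuple V)
| Eq (x y : V)
| Bot
| Imp (f g : formula L V)
| All (f : formula L (option V)).

Arguments Bot {L V}.

Definition sentence L := formula L void.

Definition Not L V (f : formula L V) : formula L V := Imp f Bot.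

Record structure (L : language) := Structure {
  carrier :> Type;
  interp : forall n, rel_symbol L n -> set (n.-tuple carrier)
}.

Fixpoint sat L (M : structure L) V (f : formula L V) : (V -> M) -> Prop :=
  match f with
  | Rel _ R t => fun v => interp R (map_tuple v t)
  | Eq x y => fun v => v x = v y
  | Bot => fun _ => False
  | Imp f g => fun v => sat f v -> sat g v
  | All f => fun v => forall a : M, sat f (oapp v a)
  end.

Definition Th L (M : structure L) : set (sentence L) :=
  [set s | sat s (of_void M)].

Definition models L (M : structure L) (T : set (sentence L)) : Prop :=
  T `<=` Th M.

Definition entails L (T : set (sentence L)) (s : sentence L) : Prop :=
  forall M : structure L, models M T -> Th M s.

Definition complete_theory L (T : set (sentence L)) : Prop :=
  (exists M : structure L, models M T) /\
  forall s, entails T s \/ entails T (Not s).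

Definition substructure L (C : structure L) (A : set C) : structure L :=
  @Structure L A (fun n R => [set t | interp R (map_tuple (fun a : A => val a) t)]).

Definition elem_equiv L (C : structure L) (A B : set C) : Prop :=
  Th (substructure A) = Th (substructure B).

(* [A] is (the universe of) an elementary submodel of the substructure [B]. *)
Definition elem_sub L (C : structure L) (A B : set C) : Prop :=
  A `<=` B /\
  forall n (f : formula L 'I_n)
         (x : n.-tuple (substructure A)) (y : n.-tuple (substructure B)),
    (forall i, val (tnth x i) = val (tnth y i)) ->
    sat f (tnth x) <-> sat f (tnth y).

(** * Formulas with parameters, types, saturation *)

(* Formulas in the variables x_0, ..., x_(n-1) with parameters in [B]. *)
Definition formula_over L (M : structure L) (B : set M) (n : nat) :=
  formula L ('I_n + B)%type.

Definition holds L (M : structure L) (B : set M) n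
    (f : formula_over B n) (x : n.-tuple M) : Prop :=
  sat f (fun u : 'I_n + B =>
           match u with inl i => tnth x i | inr b => val b end).

Definition realizes L (M : structure L) (B : set M) n
    (x : n.-tuple M) (r : set (formula_over B n)) : Prop :=
  forall f, r f -> holds f x.

Definition finitely_satisfiable L (M : structure L) (B : set M) n
    (r : set (formula_over B n)) : Prop :=
  forall r0, r0 `<=` r -> finite_set r0 -> exists x, realizes x r0.

Definition compact_struct L (lam : cardinal) (M : structure L) : Prop :=
  forall n (r : set (formula_over [set: M] n)),
    r #< [set: lam] -> finitely_satisfiable r -> exists x, realizes x r.

Definition saturated L (lam : cardinal) (M : structure L) : Prop :=
  forall B : set M, B #< [set: lam] ->
  forall n (r : set (formula_over B n)),
    finitely_satisfiable r -> exists x, realizes x r.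

Definition definable L (M : structure L) (B : set M) n
    (D : set (n.-tuple M)) : Prop :=
  exists f : formula_over B n, D = [set x | holds f x].

Definition tp L (C : structure L) (B : set C) n (c : n.-tuple C) :
    set (formula_over B n) :=
  [set f | holds f c].
Arguments tp {L C} B {n} c.

(** * The monster model *)

Definition elementary_map L (M : structure L) (A : set M) (h : A -> M) : Prop :=
  forall f : formula L A, sat f (fun a : A => val a) <-> sat f h.

Definition automorphism L (M : structure L) (g : M -> M) : Prop :=
  bijective g /\
  forall n (R : rel_symbol L n) (t : n.-tuple M),
    interp R t <-> interp R (map_tuple g t).

(* [|T|] is the number of [L]-formulas, that is |L| + aleph_0. *)
Definition card_T L : set (formula L nat) := [set: formula L nat].
Arguments card_T : clear implicits.

(* "Small" means of cardinality less than [kappa].  As [kappa] is a strong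
   limit, |A|^|T| is small whenever [A] is; for every [kappa], models that are
   [kappa]-saturated and strongly [kappa]-homogeneous exist in ZFC. *)
Record monster L (kappa : cardinal) (T : set (sentence L)) (C : structure L) :
    Prop := Monster {
  monster_models : models C T;
  monster_large : card_T L #< [set: kappa];
  monster_strong_limit : strong_limit kappa;
  monster_saturated : saturated kappa C;
  monster_homogeneous : forall (A : set C) (h : A -> C),
    A #< [set: kappa] -> elementary_map h ->
    exists g : C -> C, automorphism g /\ forall a : A, g (val a) = h a
}.

Definition small (kappa : cardinal) L (C : structure L) (A : set C) : Prop :=
  A #< [set: kappa].

(* Models of [T] are the small elementary submodels of the monster model. *)
Definition submodel (kappa : cardinal) L (C : structure L) (M : set C) : Prop :=
  small kappa M /\ elem_sub M [set: C].

(** * The predicate P *)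

Definition Pset L (P : rel_symbol L 1) (M : structure L) : set M :=
  [set a | interp P [tuple a]].
Arguments Pset {L} P M.

(* Models of T^P = Th(C^P) are the small elementary submodels of C^P. *)
Definition submodel_P (kappa : cardinal) L (P : rel_symbol L 1)
    (C : structure L) (N : set C) : Prop :=
  small kappa N /\ elem_sub N (Pset P C).

Record standing_assumptions L (P : rel_symbol L 1) (T : set (sentence L))
    (C : structure L) : Prop := StandingAssumptions {
  P_infinite : forall M : structure L, models M T -> infinite_set (Pset P M);
  P_stably_embedded : forall n (D : set (n.-tuple C)),
    (forall x, D x -> forall i, Pset P C (tnth x i)) ->
    definable [set: C] D -> definable (Pset P C) D;
  P_0_definable : forall n (D : set (n.-tuple C)),
    (forall x, D x -> forall i, Pset P C (tnth x i)) ->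
    definable set0 D ->
    definable set0
      [set x : n.-tuple (substructure (Pset P C)) |
        D (map_tuple (fun a : Pset P C => val a) x)];
  (* [L] is not required to have predicates of arity 0. *)
  QE_to_predicates : forall n (f : formula L 'I_n), (0 < n)%N ->
    exists R : rel_symbol L n,
    forall M : structure L, models M T ->
    forall x : n.-tuple M, sat f (tnth x) <-> interp R x
}.

Section OverP.
Context (kappa : cardinal) (L : language) (P : rel_symbol L 1) (C : structure L).
Implicit Types A B M N : set C.

Definition complete_set A : Prop :=
  forall n (f : formula_over A n),
    (exists x : n.-tuple C, (forall i, Pset P C (tnth x i)) /\ holds f x) ->
    exists x : n.-tuple C,
      (forall i, (A `&` Pset P C) (tnth x i)) /\ holds f x.

Definition S_star A : set {n & set (formula_over A n)} :=
  [set p | exists n (c : n.-tuple C),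
     [/\ p = existT _ n (tp A c),
         Pset P C `&` (A `|` range (tnth c)) = Pset P C `&` A &
         complete_set (A `|` range (tnth c))]].
Arguments S_star : clear implicits.

(* |A'|^|T| is the cardinality of the function type [formula L nat -> A']. *)
Definition stable_set A : Prop :=
  complete_set A /\
  forall A', small kappa A' -> elem_equiv A' A ->
    S_star A' #<= [set: formula L nat -> A'].

Definition fully_stable N : Prop :=
  forall A, small kappa A -> complete_set A -> A `&` Pset P C = N ->
    stable_set A.

Definition existence_property (lam : cardinal) A : Prop :=
  exists M, [/\ submodel kappa M, saturated lam (substructure M),
                A `<=` M & M `&` Pset P C = A `&` Pset P C].

Definition full_existence (lam : cardinal) N : Prop :=
  forall A, small kappa A -> complete_set A -> A `&` Pset P C = N ->
    existence_property lam A.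

(* The equivalence of [r] and [p] is evaluated in the monster model. *)
Definition isolated (lam : cardinal) B n (p : set (formula_over B n)) : Prop :=
  exists r : set (formula_over B n),
    [/\ r `<=` p, r #< [set: lam] &
        forall c : n.-tuple C, realizes c r <-> realizes c p].

(* The ordinal alpha is represented by a well-ordered type [I]; the relation
   [le] of [well_order] is the reflexive order. *)
Definition constructible (lam : cardinal) A M : Prop :=
  [/\ M `&` Pset P C `<=` A, A `<=` M &
      exists (I : Type) (le : rel I) (d : I -> C),
        [/\ well_order le, M = A `|` range d &
            forall i, isolated lam
              (tp (A `|` [set d j | j in [set j | le j i /\ j <> i]])
                  [tuple d i])]].

End OverP.

Arguments S_star {L} P {C} A.

(* Main.v *)
Require Import Defs.
From Stdlib Require List Eqdep_dec.
From mathcomp Require Import all_boot.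
From mathcomp Require Import boolp classical_sets functions cardinality wochoice.
From mathcomp Require Import filter.

(* The model is built by adding elements with lambda-isolated types one at a
   time, so everything rests on the density of such types: over a complete set
   A with P^A = N, every consistent type r of size less than lambda extends to
   one that is still of size less than lambda and decides psi(x, a) for all a
   in A, for a given formula psi.  Once all psi are treated, the resulting type
   isolates a complete type over A, and the compactness of N together with
   stable embeddedness shows that its realizations keep the set complete and
   add nothing to P.

   Suppose that no extension of r decides psi.  Then every consistent finite
   extension of r is split by some instance psi(x, a), and every solution in P
   required by completeness can be taken in A.  Let W be least with
   2^W > 2^|T|.  Finite parts of a tree of types of height W, in which the types
   along a branch split at each level and acquire the solutions in P required by
   completeness, can be found over A.  By an ultrafilter and Skolem functions
   the whole tree exists over some A' elementarily equivalent to A with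
   |A'| <= 2^|T|, and its branches give 2^W elements of S_*(A').  As
   |A'|^|T| <= 2^|T|, this contradicts stability. *)

Set Implicit Arguments.
Unset Strict Implicit.
Unset Printing Implicit Defensive.

Local Open Scope classical_set_scope.
Local Open Scope card_scope.

(** * Cardinal arithmetic *)

(** The choice of [W] makes the counting work: a node of level [w] is a subset of a proper segment
    of [W], so each level has at most 2^|T| nodes. Hence 2^|T| names suffice for the whole tree,
    with its witnesses and Skolem terms, although it has more than 2^|T| branches. Stability speaks
    of sets elementarily equivalent to [A] as substructures, and [A] need not be an elementary
    submodel. So the Skolem functions are those of the substructure [A], and their values may in
    turn be parameters of witnesses, which is why terms are nested.

    Only |T| formulas psi have to be decided, each by finitely many formulas, so an isolating type
    has size at most |r| + |T|, and lambda may be singular. Regularity matters for the length of the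
    final construction: it has reg(lambda) rounds, each realizing the isolated types over the set
    reached before, and any fewer than lambda parameters appear by some round. Compactness of N
    gives lambda <= |N|, so every intermediate set has at most |A|^|T| elements and at most that
    many types to realize. *)

Definition toset X (A : set X) (x : X) (Ax : A x) : A := SigSub (mem_set Ax).

Definition inj_le (X Y : Type) : Prop := exists f : X -> Y, injective f.

Lemma inj_leP X Y (A : set X) (B : set Y) : A #<= B <-> inj_le A B.
Proof.
split=> [/card_leP[f]|[f fI]].
  by exists f => x y fxy; apply: (@inj _ _ _ f) fxy; rewrite inE.
have [g gE] := @Pinj _ _ [set: A] f (fun x y _ _ => @fI x y).
by apply/card_leP; squash ('totalfun_[set: A] g).
Qed.

Lemma inj_leT X Y : [set: X] #<= [set: Y] <-> inj_le X Y.
Proof.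
rewrite inj_leP; split=> -[f fI].
  exists (fun x => val (f (SigSub (mem_set (I : [set: X] x))))) => x y.
  by move=> /val_inj/fI/(congr1 val).
exists (fun x => SigSub (mem_set (I : [set: Y] (f (val x))))) => x y.
by move=> /(congr1 val)/fI/val_inj.
Qed.

Lemma inj_leTl X Y (A : set X) : A #<= [set: Y] <-> inj_le A Y.
Proof. by rewrite -inj_leT (card_le_eql (card_setT A)). Qed.

Lemma inj_lexx X : inj_le X X.
Proof. by exists id. Qed.

Lemma inj_le_trans Y X Z : inj_le X Y -> inj_le Y Z -> inj_le X Z.
Proof.
by move=> [f fI] [g gI]; exists (g \o f); apply: inj_comp.
Qed.

Lemma inj_le_set X (A : set X) : inj_le A X.
Proof. by exists val; apply: val_inj. Qed.

Lemma inj_le_in X Y (B : set Y) (f : X -> Y) :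
  injective f -> (forall x, B (f x)) -> inj_le X B.
Proof.
move=> fI fB; exists (fun x => SigSub (mem_set (fB x))) => x y.
by move=> /(congr1 val)/fI.
Qed.

Lemma inj_le_surj X Y (B : set Y) (f : X -> Y) :
  (forall y, B y -> exists x, f x = y) -> inj_le B X.
Proof.
move=> fS; have [g gP] := choice (fun y : B => fS (val y) (set_valP y)).
by exists g => x y gxy; apply: val_inj; rewrite -gP gxy gP.
Qed.

Lemma inj_le_range X Y (f : X -> Y) : inj_le (range f) X.
Proof. by apply: (inj_le_surj (f := f)) => y [x _ <-]; exists x. Qed.

Lemma inj_le_sub X (A B : set X) : A `<=` B -> inj_le A B.
Proof.
move=> AB; apply: (inj_le_in (f := val)) => [|x]; first exact: val_inj.
exact/AB/set_valP.
Qed.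

Lemma inj_le_surjT X Y (f : X -> Y) : (forall y, exists x, f x = y) -> inj_le Y X.
Proof. by move=> /choice[g gP]; exists g => x y gxy; rewrite -(gP x) gxy. Qed.

Lemma inj_le_surjective X Y : inj_le X Y -> X -> exists g : Y -> X, forall x, exists y, g y = x.
Proof.
move=> [f fI] x0.
exists (fun y => if pselect (exists x, f x = y) is left h then projT1 (cid h) else x0).
move=> x; exists (f x); case: pselect => [h|[]]; last by exists x.
by case: cid => z /= /fI.
Qed.

Lemma inj_le_prod X Y X' Y' : inj_le X X' -> inj_le Y Y' -> inj_le (X * Y) (X' * Y').
Proof.
move=> [f fI] [g gI]; exists (fun p => (f p.1, g p.2)) => -[a b] [c d] /= [].
by move=> /fI-> /gI->.
Qed.

Lemma inj_le_sum X Y X' Y' : inj_le X X' -> inj_le Y Y' -> inj_le (X + Y) (X' + Y').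
Proof.
move=> [f fI] [g gI].
exists (fun u => match u with inl x => inl (f x) | inr y => inr (g y) end).
by move=> [a|a] [b|b] //= [] => [/fI->|/gI->].
Qed.

Lemma inj_le_pow X Y Z : inj_le X Y -> inj_le (Z -> X) (Z -> Y).
Proof.
move=> [f fI]; exists (fun h => f \o h) => h k hk; apply/funext => z.
by apply: fI; rewrite -/((f \o h) z) hk.
Qed.

Lemma inj_le_set_mono X Y : inj_le X Y -> inj_le (set X) (set Y).
Proof.
move=> [f fI]; exists (fun A => f @` A) => A B AB; apply/seteqP; split=> x Ax.
    have [y By /fI<- //] : (f @` B) (f x) by rewrite -AB; exists x.
have [y By /fI<- //] : (f @` A) (f x) by rewrite AB; exists x.
Qed.

Lemma Cantor X : ~ inj_le (set X) X.
Proof.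
move=> [f fI]; pose D := [set f A | A in [set A | ~ A (f A)]].
have [DD|DD] := pselect (D (f D)); last by apply: (DD); exists D.
by have [A AP /fI AD] := DD; apply: AP; rewrite AD.
Qed.

(** * Well-orderings *)

Record is_wo X (lt : X -> X -> Prop) : Prop := IsWo {
  wo_wf : well_founded lt;
  wo_trans : forall x y z, lt x y -> lt y z -> lt x z;
  wo_total : forall x y, [\/ lt x y, x = y | lt y x]
}.

Definition seg X (lt : X -> X -> Prop) (x : X) : set X := [set y | lt y x].

Lemma wo_irr X (lt : X -> X -> Prop) : is_wo lt -> forall x, ~ lt x x.
Proof. by case=> wf _ _; elim/(well_founded_ind wf) => x IH xx; apply: (IH x). Qed.

Lemma wf_min X (lt : X -> X -> Prop) : well_founded lt -> forall A : set X,
  A !=set0 -> exists2 x, A x & forall y, A y -> ~ lt y x.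
Proof.
move=> wf A [x Ax]; elim/(well_founded_ind wf): x Ax => x IH Ax.
have [[y [Ay yx]]|h] := pselect (exists y, A y /\ lt y x); first exact: IH yx Ay.
by exists x => // y Ay yx; apply: h; exists y.
Qed.

Lemma well_orderable X : exists lt : X -> X -> Prop, is_wo lt.
Proof.
have [R Rwo] := well_ordering_principle {classic X}.
pose lt (x y : X) := R x y /\ x <> y.
have minR (A : set X) : A !=set0 -> exists2 x, A x & forall y, A y -> R x y.
  move=> [x0 Ax0]; case: (Rwo (fun x : {classic X} => x \in A)).
    by exists x0; apply: mem_set.
  move=> x [[Ax xm] _]; exists x; first exact: set_mem Ax.
  by move=> y Ay; apply: xm; apply: mem_set.
have Rwc : @wo_chain {classic X} R predT by move=> A _; apply: Rwo.
have Rtot x y : R x y \/ R y x by apply/orP; apply: (wo_chainW Rwc).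
have Rrefl x : R x x by case: (Rtot x x).
have Ranti x y : R x y -> R y x -> x = y.
  by move=> xy yx; apply: (wo_chain_antisymmetric Rwc) => //; rewrite xy yx.
have Rtr x y z : R x y -> R y z -> R x z.
  move=> xy yz; have [|u uA um] := minR [set x; y; z]; first by exists x; left; left.
  have ux : R u x by apply: um; left; left.
  have uy : R u y by apply: um; left; right.
  have uz : R u z by apply: um; right.
  case: uA => [[E|E]|E]; first by rewrite -E.
    by rewrite (Ranti x y) // -E.
  by rewrite -(Ranti y z) // -E.
exists lt; split.
- move=> x; apply: contrapT => nx.
  have [|y ny ym] := minR [set y | ~ Acc lt y]; first by exists x.
  apply: ny; constructor => z [zy nzy]; apply: contrapT => nz.
  by apply: nzy; apply: Ranti => //; apply: ym.
- move=> x y z [xy nxy] [yz nyz]; split; first exact: Rtr yz.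
  by move=> xz; subst z; apply: nxy; apply: Ranti.
- move=> x y; have [->|xy] := pselect (x = y); first exact: Or32.
  by have [h|h] := Rtot x y; [apply: Or31|apply: Or33]; split=> //; apply: nesym.
Qed.

Lemma is_wo_pull X Y (lt : Y -> Y -> Prop) (f : X -> Y) :
  injective f -> is_wo lt -> is_wo (fun x y => lt (f x) (f y)).
Proof.
move=> fI ltwo; split.
- move=> x; move: {2}(f x) (erefl (f x)) => y.
  elim/(well_founded_ind (wo_wf ltwo)): y x => y IH x xy.
  by constructor => z zx; apply: (IH (f z)); rewrite -?xy.
- by move=> x y z; apply: wo_trans.
- by move=> x y; have [h|/fI->|h] := wo_total ltwo (f x) (f y);
    [apply: Or31|apply: Or32|apply: Or33].
Qed.

Lemma wo_well_order (I : Type) (lt : I -> I -> Prop) : is_wo lt ->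
  well_order (fun i j => `[< lt i j \/ i = j >]).
Proof.
move=> ltwo A [i0 Ai0].
have [i Ai im] := wf_min (wo_wf ltwo) (ex_intro _ i0 (Ai0 : [set i | i \in A] i0)).
have ile j : j \in A -> lt i j \/ i = j.
  by move=> Aj; case: (wo_total ltwo i j) => [h|h|/(im _ Aj)//]; [left|right].
exists i; split; first by split=> // j Aj; apply/asboolP/ile.
by move=> j [Aj jm]; have /asboolP[/(im _ Aj)|] := jm _ Ai.
Qed.

(** The earlier values reach [G] as a graph, a relation between [j] and [z], so that no function on
    a segment has to be extended or compared. *)
Lemma wf_rec (I Z : Type) (lt : I -> I -> Prop) (G : I -> (I -> Z -> Prop) -> Z) :
  well_founded lt ->
  exists f : I -> Z, forall i, f i = G i (fun j z => lt j i /\ f j = z).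
Proof.
move=> wf.
pose F i (rec : forall j, lt j i -> Z) := G i (fun j z => exists h : lt j i, rec j h = z).
exists (Fix wf (fun=> Z) F) => i; rewrite Fix_eq.
  congr G; apply/funext => j; apply/funext => z; apply/propext.
  by split=> [[h <-]|[h <-]]; [|exists h].
move=> {}i f g fg; suff -> : f = g by [].
by do 2![apply: functional_extensionality_dep => ?].
Qed.

(** The value is [z0] where no choice is possible; a user shows afterwards, by induction if
    necessary, that [S] can be solved at every stage. *)
Lemma wf_choose (I Z : Type) (lt : I -> I -> Prop)
    (S : I -> (I -> Z -> Prop) -> Z -> Prop) (z0 : Z) :
  well_founded lt ->
  exists f : I -> Z, forall i,
    let r := fun j z => lt j i /\ f j = z in (exists z, S i r z) -> S i r (f i).
Proof.
move=> wf.
pose G i r := if pselect (exists z, S i r z) is left h then projT1 (cid h) else z0.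
have [f fE] := wf_rec G wf; exists f => i /= h.
by rewrite fE /G; case: pselect => // {}h; case: cid.
Qed.

(** Replaces the least cardinal with property [Q]: a well-ordering of [X] is cut at the least point
    whose segment has [Q], or kept whole. Initial orderings, successor cardinals, reg(lambda) and
    [W] all come from it. *)
Lemma least_segment (X : Type) (Q : Type -> Prop) :
  (forall A B, Q A -> inj_le A B -> Q B) -> Q X ->
  exists (S : Type) (lt : S -> S -> Prop),
    [/\ is_wo lt, Q S, inj_le S X & forall s, ~ Q (seg lt s)].
Proof.
move=> Qmono QX; have [lt ltwo] := well_orderable X.
have [[x Qx]|nQ] := pselect (exists x, Q (seg lt x)); last first.
  by exists X, lt; split=> //; [exact: inj_lexx|move=> s Qs; apply: nQ; exists s].
have [y Qy ym] := wf_min (wo_wf ltwo) (ex_intro _ x (Qx : [set x | Q (seg lt x)] x)).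
exists (seg lt y), (fun u v => lt (val u) (val v)); split.
- exact: (is_wo_pull val_inj).
- exact: Qy.
- exact: inj_le_set.
- move=> s Qs; apply: (ym (val s)) (set_valP s); apply: Qmono Qs _.
  exists (fun u => toset (set_valP u : seg lt (val s) (val (val u)))).
  by move=> u v /(congr1 val) /= /val_inj/val_inj.
Qed.

Lemma inj_le_of_segs (S Z : Type) (lt : S -> S -> Prop) : is_wo lt ->
  (forall s, ~ inj_le Z (seg lt s)) -> inj_le S Z.
Proof.
move=> ltwo nle.
have [[s0]|ns] := pselect (exists s : S, True); last first.
  by exists (fun s => False_rect Z (ns (ex_intro _ s I))) => s; case: ns; exists s.
have Z0 : Z.
  apply: (projT1 (cid (_ : exists z : Z, True))); apply: contrapT => nz.
  apply: (nle s0); exists (fun z => False_rect _ (nz (ex_intro _ z I))) => z.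
  by case: nz; exists z.
have [f fP] := wf_choose (fun (i : S) r z => forall j, ~ r j z) Z0 (wo_wf ltwo).
have fnew s t : lt t s -> f t <> f s.
  move=> ts tsE; have /fP : exists z, forall j, ~ (lt j s /\ f j = z).
    apply: contrapT => nz; apply: (nle s).
    apply: (inj_le_trans _ (inj_lexx _)).
    have gP z : exists j : seg lt s, f (val j) = z.
      apply: contrapT => nj; apply: nz; exists z => j [js fj]; apply: nj.
      by exists (toset (js : seg lt s j)).
    exact: (inj_le_surjT (f := f \o val)).
  by move/(_ t); apply.
exists f => s t fst; have [/fnew|//|/fnew] := wo_total ltwo s t => //.
by move=> h; case: h.
Qed.

Lemma inj_le_total X Y : inj_le X Y \/ inj_le Y X.
Proof.
have [lt ltwo] := well_orderable X.
have [[s Ys]|h] := pselect (exists s, inj_le Y (seg lt s)).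
  by right; apply: inj_le_trans Ys (inj_le_set _).
by left; apply: inj_le_of_segs ltwo _ => s Ys; apply: h; exists s.
Qed.

Lemma not_inj_le X Y : ~ inj_le X Y -> inj_le Y X.
Proof. by have [] := inj_le_total X Y. Qed.

Lemma card_ltT X Y : [set: X] #< [set: Y] <-> ~ inj_le Y X.
Proof.
rewrite /card_lt !inj_leT; split=> [[_ //]|h]; split=> //; exact: not_inj_le.
Qed.

Lemma card_ltTl X Y (A : set X) : A #< [set: Y] <-> ~ inj_le Y A.
Proof.
rewrite -card_ltT /card_lt (card_le_eql (card_setT A)).
by rewrite (card_le_eqr (card_setT A)).
Qed.

Lemma initial_wo X : exists lt : X -> X -> Prop,
  is_wo lt /\ forall x, ~ inj_le X (seg lt x).
Proof.
have [|S [lt [ltwo [f fI] _ nQ]]] := @least_segment X (inj_le X) _ (inj_lexx X).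
  by move=> A B; apply: inj_le_trans.
exists (fun x y => lt (f x) (f y)); split; first exact: is_wo_pull.
move=> x Xx; apply: (nQ (f x)); apply: inj_le_trans Xx _.
apply: (inj_le_in (f := f \o val)) => [|y]; last exact: (set_valP y).
by apply: inj_comp => //; apply: val_inj.
Qed.

(** * Squares and finite sequences of infinite sets *)

Lemma inj_le_nat2 : inj_le (nat * nat) nat.
Proof. by exists pickle; apply: pcan_inj (@pickleK (nat * nat)%type). Qed.

Lemma inj_le_sum_prod X : inj_le nat X -> inj_le (X + X) (X * X).
Proof.
move=> [e eI].
exists (fun u => match u with inl x => (e 0, x) | inr x => (e 1, x) end).
by move=> [x|x] [y|y] [] => [->|/eI|/eI|->].
Qed.

Section Square.
Variable X : Type.

Let dom (G : set (X * X * X)) : set X := [set x | exists z, G (x, x, z)].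

(* Zorn's lemma is applied to the graphs of injections D * D -> D with D infinite:
   by maximality the complement of D embeds in D. *)
Let pairing (G : set (X * X * X)) : Prop :=
  [/\ forall p z z', G (p, z) -> G (p, z') -> z = z',
      forall p p' z, G (p, z) -> G (p', z) -> p = p',
      forall x y z, G (x, y, z) -> [/\ dom G x, dom G y & dom G z],
      forall x y, dom G x -> dom G y -> exists z, G (x, y, z) &
      inj_le nat (dom G)].

Let pairing_bigcup (F : set (set (X * X * X))) (G0 : set (X * X * X)) :
  F G0 -> (forall G, F G -> G = set0 \/ pairing G) -> total_on F subset ->
  pairing G0 -> pairing (\bigcup_(G in F) G).
Proof.
move=> FG0 FP Ftot G0P; set U := \bigcup_(G in F) G.
have FU G : F G -> G `<=` U by move=> FG p Gp; exists G.
have domU G : F G -> dom G `<=` dom U by move=> FG x [z Gz]; exists z; apply: FU Gz.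
have two p q : U p -> U q -> exists G, [/\ F G, pairing G, G p & G q].
  move=> [G FG Gp] [H FH Hq].
  have [GH|HG] := Ftot _ _ FG FH; [exists H|exists G]; split=> //.
  - by have [E|//] := FP _ FH; rewrite E in Hq.
  - exact: GH.
  - by have [E|//] := FP _ FG; rewrite E in Gp.
  - exact: HG.
split.
- by move=> p z z' Up Up'; have [G [_ [+ _ _ _ _] Gp]] := two _ _ Up Up'; apply.
- by move=> p p' z Up Up'; have [G [_ [_ + _ _ _] Gp]] := two _ _ Up Up'; apply.
- move=> x y z Uz; have [G [FG [_ _ h _ _] Gz _]] := two _ _ Uz Uz.
  by have [dx dy dz] := h _ _ _ Gz; split; apply: domU FG _ _.
- move=> x y [z Uz] [t Ut]; have [G [FG [_ _ _ h _] Gz Gt]] := two _ _ Uz Ut.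
  by have [||r Gr] := h x y; [exists z|exists t|exists r; apply: FU Gr].
- by have [_ _ _ _ h] := G0P; apply: inj_le_trans h (inj_le_sub (domU _ FG0)).
Qed.

Let pairing_inj G : pairing G -> inj_le (dom G * dom G) (dom G).
Proof.
move=> [_ GI Gd Gs _].
have Gs' (p : dom G * dom G) : exists z, G (val p.1, val p.2, z).
  by apply: Gs; apply: set_valP.
have [f fP] := choice Gs'.
apply: (inj_le_in (f := f)) => [p q pq|p]; last by have [] := Gd _ _ _ (fP p).
have := GI _ _ _ (fP p); rewrite pq => /(_ _ (fP q)).
by case: p q {pq} => a b [c d] /= [/val_inj-> /val_inj->].
Qed.

(** The complement of the domain contains a copy of the domain, by [j]. The new domain is the union
    of both, and pairs not inside the old domain are sent injectively into the copy, away from the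
    old values. *)
Let pairing_extend G : pairing G -> ~ inj_le (~` dom G) (dom G) ->
  exists2 H, G `<` H & pairing H.
Proof.
move=> GP /not_inj_le[j jI]; have [G1 G2 G3 G4 G5] := GP.
have D2 := pairing_inj GP.
have S1 := inj_le_trans (inj_le_sum_prod G5) D2.
have [k kI] := inj_le_trans (inj_le_prod S1 S1) D2.
pose e (u : dom G + dom G) := match u with inl d => val d | inr d => val (j d) end.
pose isl (u : dom G + dom G) := if u is inl _ then true else false.
have nD d : ~ dom G (val (j d)) by exact: (set_valP (j d)).
have D0 (d : dom G) : dom G (val d) by exact: (set_valP d).
have eI : injective e.
  move=> [d|d] [d'|d'] /=; rewrite /e.
  - by move=> /val_inj->.
  - by move=> h; case: (nD d'); apply: eq_ind (D0 d) _ h.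
  - by move=> h; case: (nD d); apply: eq_ind_r (D0 d') _ h.
  - by move=> /val_inj/jI->.
have eD u : dom G (e u) -> isl u by case: u => //= d /nD.
pose H := G `|` [set t | exists u v, ~~ (isl u && isl v) /\
  t = (e u, e v, val (j (k (u, v))))].
have GD x y z : G (x, y, z) -> dom G x /\ dom G y by move=> /G3[].
have new u v : ~~ (isl u && isl v) -> H (e u, e v, val (j (k (u, v)))).
  by move=> uv; right; exists u, v.
have nG u v z : ~~ (isl u && isl v) -> ~ G (e u, e v, z).
  by move=> /negP uv /GD[/eD hu /eD hv]; apply: uv; rewrite hu hv.
have domH u : dom H (e u).
  case: u => d /=; last by exists (val (j (k (inr d, inr d)))); apply: (new (inr d) (inr d)).
  by have [z Gz] := D0 d; exists z; left.
have domG x : dom G x -> exists u, e u = x.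
  by move=> Dx; exists (inl (toset Dx)).
have domHG x : dom G x -> dom H x by move=> /domG[u <-].
have domHE x : dom H x -> exists u, e u = x.
  move=> [z [Gz|[u [v [_ [-> _ _]]]]]]; last by exists u.
  by apply: domG; exists z.
exists H.
  split; first by move=> t Gt; left.
  have [n nI] := G5; move=> /(_ _ (new (inr (n 0)) (inr (n 0)) isT)).
  by apply: nG.
split.
- move=> p z z' [Gz|[u [v [uv E]]]] [Gz'|[u' [v' [uv' E']]]].
  + exact: G1 Gz Gz'.
  + by case: E' Gz => -> _ /nG.
  + by case: E Gz' => -> _ /nG.
  + by move: E'; case: E => -> -> [/eI-> /eI->].
- move=> p p' z [Gz|[u [v [uv E]]]] [Gz'|[u' [v' [uv' E']]]].
  + exact: G2 Gz Gz'.
  + by case: p Gz => x y /G3[_ _]; case: E' => _ -> /nD.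
  + by case: p' Gz' => x y /G3[_ _]; case: E => _ -> /nD.
  + by move: E'; case: E => -> -> [-> /val_inj/jI/kI [-> ->]].
- move=> x y z [Gz|[u [v [uv [-> -> ->]]]]]; last first.
    by split=> //; apply: (domH (inr _)).
  by have [dx dy dz] := G3 _ _ _ Gz; split; apply: domHG.
- move=> x y /domHE[u <-] /domHE[v <-].
  have [/andP[]|uv] := boolP (isl u && isl v); last first.
    by exists (val (j (k (u, v)))); apply: new.
  case: u v => [d|//] [d'|//] _ _ /=.
  by have [z Gz] := G4 _ _ (D0 d) (D0 d'); exists z; left.
- exact: inj_le_trans G5 (inj_le_sub domHG).
Qed.

Lemma inj_le_square : inj_le nat X -> inj_le (X * X) X.
Proof.
move=> [e eI].
have [pr prI] := inj_le_nat2.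
pose B := [set t | exists m n, t = (e m, e n, e (pr (m, n)))] : set (X * X * X).
have BP : pairing B.
  have dB n : dom B (e n) by exists (e (pr (n, n))), n, n.
  split.
  - by move=> p z z' [m [n [-> ->]]] [m' [n' [/eI-> /eI-> ->]]].
  - by move=> p p' z [m [n [-> ->]]] [m' [n' [-> /eI/prI[-> ->]]]].
  - by move=> x y z [m [n [-> -> ->]]].
  - move=> x y [z [m [_ [-> _ _]]]] [t [n [_ [-> _ _]]]].
    by exists (e (pr (m, n))), m, n.
  - exact: inj_le_in eI dB.
have [|A [AP Amax]] := @Zorn_bigcup _ [set G | G = set0 \/ pairing G].
  move=> F FP Ftot.
  have [[G [FG GP]]|nF] := pselect (exists G, F G /\ pairing G).
    by right; apply: (pairing_bigcup FG FP Ftot GP).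
  left; apply/seteqP; split=> // p [G FG Gp].
  have [E|GP] := FP _ FG; first by rewrite E in Gp.
  by case: nF; exists G.
have {}AP : pairing A.
  have [E|//] := AP; case: (Amax B); last by right.
  rewrite E; split=> // /(_ (e 0, e 0, e (pr (0, 0)))); apply.
  by exists 0, 0.
have [le|nle] := pselect (inj_le (~` dom A) (dom A)); last first.
  by have [H AH HP] := pairing_extend AP nle; case: (Amax H AH); right.
have D2 := pairing_inj AP; have [_ _ _ _ G5] := AP.
have XD : inj_le X (dom A).
  apply: inj_le_trans (inj_le_trans (inj_le_sum_prod G5) D2).
  apply: inj_le_trans (inj_le_sum (inj_lexx (dom A)) le).
  exists (fun x => match pselect (dom A x) with
    left h => inl (toset h) | right h => inr (toset (h : (~` dom A) x)) end).
  by move=> x y; case: pselect => hx; case: pselect => hy //; case.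
exact: inj_le_trans (inj_le_prod XD XD) (inj_le_trans D2 (inj_le_set _)).
Qed.

End Square.

Lemma inj_le_seq X : inj_le nat X -> inj_le (seq X) X.
Proof.
move=> nX; have [p pI] := inj_le_square nX.
apply: inj_le_trans (inj_le_trans (inj_le_prod nX (inj_lexx X)) (inj_le_square nX)).
have [e _] := nX.
pose c := foldr (fun x y => p (x, y)) (e 0).
exists (fun s => (size s, c s)); elim=> [|x s IH] [|y t] //= [st /pI[-> h]].
by congr cons; apply: IH; rewrite st h.
Qed.

Lemma inj_le_sumX X : inj_le nat X -> inj_le (X + X) X.
Proof. by move=> h; apply: inj_le_trans (inj_le_sum_prod h) (inj_le_square h). Qed.

Definition inj_lt (X Y : Type) : Prop := ~ inj_le Y X.

Lemma inj_ltW X Y : inj_lt X Y -> inj_le X Y.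
Proof. exact: not_inj_le. Qed.

Lemma inj_le_lt_trans Y X Z : inj_le X Y -> inj_lt Y Z -> inj_lt X Z.
Proof. by move=> XY YZ ZX; apply: YZ; apply: inj_le_trans XY. Qed.

Lemma inj_lt_le_trans Y X Z : inj_lt X Y -> inj_le Y Z -> inj_lt X Z.
Proof. by move=> XY YZ ZX; apply: XY; apply: inj_le_trans ZX. Qed.

Lemma inj_lt_common L X Y : inj_lt nat L -> inj_lt X L -> inj_lt Y L ->
  exists Z, [/\ inj_lt Z L, inj_le nat Z, inj_le X Z & inj_le Y Z].
Proof.
move=> nL.
have two A B : inj_lt A L -> inj_lt B L ->
    exists Z, [/\ inj_lt Z L, inj_le A Z & inj_le B Z].
  move=> AL BL; have [h|h] := inj_le_total A B.
    by exists B; split=> //; apply: inj_lexx.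
  by exists A; split=> //; apply: inj_lexx.
move=> XL YL; have [Z [ZL XZ YZ]] := two _ _ XL YL.
have [V [VL ZV nV]] := two _ _ ZL nL.
by exists V; split=> //; [apply: inj_le_trans XZ ZV|apply: inj_le_trans YZ ZV].
Qed.

Lemma inj_lt_prod L X Y : inj_lt nat L -> inj_lt X L -> inj_lt Y L -> inj_lt (X * Y) L.
Proof.
move=> nL XL YL; have [Z [ZL nZ XZ YZ]] := inj_lt_common nL XL YL.
apply: inj_le_lt_trans ZL; apply: inj_le_trans (inj_le_square nZ).
exact: inj_le_prod.
Qed.

Lemma inj_lt_sum L X Y : inj_lt nat L -> inj_lt X L -> inj_lt Y L -> inj_lt (X + Y) L.
Proof.
move=> nL XL YL; have [Z [ZL nZ XZ YZ]] := inj_lt_common nL XL YL.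
apply: inj_le_lt_trans ZL; apply: inj_le_trans (inj_le_sumX nZ).
exact: inj_le_sum.
Qed.

Lemma inj_lt_seq L X : inj_lt nat L -> inj_lt X L -> inj_lt (seq X) L.
Proof.
move=> nL XL; have [Z [ZL nZ [f fI] _]] := inj_lt_common nL XL XL.
apply: inj_le_lt_trans ZL; apply: inj_le_trans (inj_le_seq nZ).
by exists (map f); apply: inj_map.
Qed.

Lemma inj_lt_option L X : inj_lt nat L -> inj_lt X L -> inj_lt (option X) L.
Proof.
move=> nL XL; apply: inj_le_lt_trans (inj_lt_sum nL XL nL).
by exists (fun o => if o is Some x then inl x else inr 0) => -[x|] [y|] // [->].
Qed.

Lemma inj_le_setU X (A B : set X) : inj_le (A `|` B) (A + B).
Proof.
have h (x : A `|` B) : exists u : A + B,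
    val x = match u with inl a => val a | inr b => val b end.
  by case: (set_valP x) => p; [exists (inl (toset p))|exists (inr (toset p))].
have [f fP] := choice h; exists f => x y fxy; apply: val_inj.
by rewrite fP fxy -fP.
Qed.

Lemma inj_le_bigcup K X (I : set K) (F : K -> set X) Z : inj_le nat Z ->
  inj_le I Z -> (forall i, I i -> inj_le (F i) Z) -> inj_le (\bigcup_(i in I) F i) Z.
Proof.
move=> nZ IZ FZ; apply: inj_le_trans (inj_le_square nZ).
apply: inj_le_trans (inj_le_prod IZ (inj_lexx Z)).
have [n _] := nZ; pose z0 := n 0.
have FZ' (i : I) : exists h : X -> Z, forall x y, F (val i) x -> F (val i) y -> h x = h y -> x = y.
  have [h hI] := FZ _ (set_valP i).
  exists (fun x => if pselect (F (val i) x) is left p then h (toset p) else z0).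
  move=> x y Fx Fy; case: pselect => // {}Fx; case: pselect => // {}Fy.
  by move=> /hI/(congr1 val).
have [g gI] := choice FZ'.
have h (x : \bigcup_(i in I) F i) : exists t : I * Z,
    F (val t.1) (val x) /\ g t.1 (val x) = t.2.
  by have [i Ii Fx] := set_valP x; exists (toset Ii, g (toset Ii) (val x)).
have [f fP] := choice h; exists f => x y fxy; apply: val_inj.
have [Fx gx] := fP x; have [Fy gy] := fP y; rewrite fxy in Fx gx.
by apply: (gI _ _ _ Fx Fy); rewrite gx gy.
Qed.

Lemma strong_limitP K X : strong_limit K -> inj_lt X K -> inj_lt (set X) K.
Proof.
move=> Ksl XK; have [f fI] := inj_ltW XK.
have rX : inj_le X (range f) by apply: inj_le_in fI _ => x; exists x.
apply: (@inj_le_lt_trans (set (range f))); first exact: inj_le_set_mono.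
apply/card_ltT; apply: Ksl; apply/card_ltTl.
exact: inj_le_lt_trans (inj_le_range f) XK.
Qed.

Lemma inj_lt_pow K X Y : inj_lt nat K -> strong_limit K ->
  inj_lt X K -> inj_lt Y K -> inj_lt (X -> Y) K.
Proof.
move=> nK Ksl XK YK; apply: inj_le_lt_trans (strong_limitP Ksl (inj_lt_prod nK XK YK)).
exists (fun f => [set p | f p.1 = p.2]) => f g fg; apply/funext => x.
by have : [set p | g p.1 = p.2] (x, f x) by rewrite -fg.
Qed.

(** * Regular cardinals *)

(** [S] is the successor cardinal of [Y]; by Cantor's theorem it is found inside a well-ordering of
    [set Y]. *)
Lemma hartogs Y : exists (S : Type) (lt : S -> S -> Prop),
  [/\ is_wo lt, ~ inj_le S Y & forall s, inj_le (seg lt s) Y].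
Proof.
have [|S [lt [? ? _ h]]] := @least_segment (set Y) (fun A => ~ inj_le A Y) _ (@Cantor Y).
  by move=> A B nA AB BY; apply: nA; apply: inj_le_trans BY.
by exists S, lt; split=> // s; apply: contrapT.
Qed.

Lemma hartogs_least (S Y Z : Type) (lt : S -> S -> Prop) : is_wo lt ->
  (forall s, inj_le (seg lt s) Y) -> ~ inj_le Z Y -> inj_le S Z.
Proof.
move=> ltwo sY ZY; apply: inj_le_of_segs ltwo _ => s Zs.
by apply: ZY; apply: inj_le_trans Zs _.
Qed.

(** A set smaller than [S] embeds in [Y], and a union of at most |Y| sets that embed in [Y] embeds
    in [Y * Y], hence in [Y]. *)
Lemma hartogs_regular (S : Type) (Y : Type) (lt : S -> S -> Prop) : inj_le nat Y -> is_wo lt ->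
  ~ inj_le S Y -> (forall s, inj_le (seg lt s) Y) -> regular S.
Proof.
move=> nY ltwo SY sY.
have leY X (A : set X) : A #< [set: S] -> inj_le A Y.
  move=> /card_ltTl AS; apply: contrapT => AY; apply: AS.
  exact: hartogs_least ltwo sY AY.
split.
  by apply/infiniteP/inj_leT; apply: inj_le_trans nY (not_inj_le SY).
move=> I F /leY IY FS E; apply: SY.
apply: (@inj_le_trans [set: S]); first exact: (inj_le_in (f := id)).
rewrite -E; apply: inj_le_bigcup => // i Ii; exact/leY/FS.
Qed.

(** The successor of [lam] is regular and bounds the search for the least regular cardinal. Full
    existence needs this, since its statement provides no [reg_lam]. *)
Lemma is_reg_exists (lam : cardinal) : inj_le nat lam -> exists R : cardinal, is_reg lam R.
Proof.
move=> nl; have [S [lt [ltwo Sl sl]]] := hartogs lam.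
pose Q (A : Type) := exists R : cardinal, [/\ regular R, inj_le lam R & inj_le R A].
have [||S0 [lt0 [lt0wo [R [Rreg lR RS0]] _ nQ]]] := @least_segment S Q.
- by move=> A B [R [? ? RA]] AB; exists R; split=> //; apply: inj_le_trans RA AB.
- exists S; split; [exact: (hartogs_regular nl ltwo)|exact: not_inj_le|exact: inj_lexx].
exists R; split=> //; first exact/inj_leT.
move=> R' R'reg /inj_leT lR'; apply/inj_leT; apply: inj_le_trans RS0 _.
apply: inj_le_of_segs lt0wo _ => s R's; apply: (nQ s).
by exists R'.
Qed.

(** Holds because the successor of [lam] is regular and thus at least [R]. *)
Lemma is_reg_lt (lam R : cardinal) X : inj_le nat lam -> is_reg lam R ->
  inj_lt X R -> inj_le X lam.
Proof.
move=> nl [_ _ Rmin] XR; apply: contrapT => Xl; apply: XR.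
have [S [lt [ltwo Sl sl]]] := hartogs lam.
apply: inj_le_trans (hartogs_least ltwo sl Xl); apply/inj_leT.
apply: Rmin; first exact: (hartogs_regular nl ltwo).
exact/inj_leT/not_inj_le.
Qed.

(** If [B] were unbounded, [R] would be the union of fewer than [R] closed initial segments, each
    smaller than [R]. *)
Lemma regular_bounded (R : cardinal) (lt : R -> R -> Prop) (B : set R) :
  inj_lt nat R -> regular R -> is_wo lt -> (forall r, ~ inj_le R (seg lt r)) ->
  inj_lt B R -> exists r, forall b, B b -> lt b r.
Proof.
move=> nR [_ Rreg] ltwo seglt BR; apply: contrapT => nb.
apply: (Rreg B (fun b => seg lt b `|` [set b])); first exact/card_ltTl.
  move=> i _; apply/card_ltTl; apply: inj_le_lt_trans (inj_le_setU _ _) _.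
  apply: inj_lt_sum => //; first exact: seglt.
  apply: inj_le_lt_trans nR; exists (fun=> 0) => x y _; apply: val_inj.
  by rewrite (set_valP x) (set_valP y).
apply/seteqP; split=> // r _; apply: contrapT => nr; apply: nb; exists r => b Bb.
have [//|E|rb] := wo_total ltwo b r; case: nr; exists b => //.
  by right.
by left.
Qed.

(** * Subsets of a well-ordered set *)

Lemma wo_list_bound W (lt : W -> W -> Prop) : is_wo lt -> (forall w, exists w', lt w w') ->
  W -> forall ws : list W, exists w, forall v, List.In v ws -> lt v w.
Proof.
move=> ltwo nomax w0; elim=> [|w ws [v IH]]; first by exists w0.
have [w' ww'] := nomax w.
have [vw'|E|w'v] := wo_total ltwo v w'.
- by exists w' => u [<-//|/IH uv]; apply: wo_trans uv vw'.
- by subst; exists w' => u [<-//|/IH].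
- by exists v => u [<-|/IH//]; apply: wo_trans ww' w'v.
Qed.

(* [W] is the least well-ordered type with more than [X] subsets, and [node w A]
   codes the part of [A] below [w]. *)
Lemma power_tree X : inj_le nat X -> exists (W : Type) (lt : W -> W -> Prop)
    (node : W -> set W -> X),
  [/\ is_wo lt, ~ inj_le (set W) X, inj_le W X,
      forall w, exists w', lt w w' &
      forall w A B, node w A = node w B <-> (forall v, lt v w -> A v <-> B v)].
Proof.
move=> nX.
have [|W [lt [ltwo WX WleX sX]]] := @least_segment X (fun A => ~ inj_le (set A) X) _ (@Cantor X).
  move=> A B nA AB BX; apply: nA; apply: inj_le_trans BX; exact: inj_le_set_mono.
have {}sX w : inj_le (set (seg lt w)) X by apply: contrapT; apply: sX.
pose c w := projT1 (cid (sX w)).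
have cI w : injective (c w) := projT2 (cid (sX w)).
exists W, lt, (fun w A => c w [set u | A (val u)]); split=> //.
  (* If [w] were last, a subset of [W] would amount to its part below [w] and one bit, and [set W]
     would embed in [X]. *)
  move=> w; apply: contrapT => wmax; apply: WX.
  have X2 : inj_le (X * bool) X.
    apply: inj_le_trans (inj_le_square nX); apply: inj_le_prod (inj_lexx _) _.
    by apply: inj_le_trans nX; exists nat_of_bool; case; case.
  apply: inj_le_trans X2.
  exists (fun A => (c w [set u | A (val u)], `[< A w >])) => A B [/cI AB ABw].
  apply/funext => v; have [vw|->|wv] := wo_total ltwo v w.
  - by have /(congr1 (fun S => S (toset (vw : seg lt w v)))) := AB.
  - by apply/propext; split=> h; apply/asboolP; [rewrite -ABw|rewrite ABw]; apply/asboolP.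
  - by case: wmax; exists v.
move=> w A B; split=> [/cI AB v vw|AB].
  have /(congr1 (fun S => S (toset (vw : seg lt w v)))) /= := AB.
  by move=> ->.
congr c; apply/funext => u; apply/propext; apply: AB; exact: (set_valP u).
Qed.

(** * Formulas *)

Lemma In_cat T (x : T) s t : List.In x (s ++ t) <-> List.In x s \/ List.In x t.
Proof. exact: List.in_app_iff. Qed.

Lemma finite_setE T (A : set T) : finite_set A -> exists s, forall x, A x <-> List.In x s.
Proof.
move=> /(@finite_seqP {classic T})[s ->]; exists s => x /=.
elim: s => //= y s IH; rewrite inE; split=> [/orP[/eqP->|/IH]|[->|/IH->]];
  by [left|right|rewrite eqxx|rewrite orbT].
Qed.

Lemma In_finite_set T (s : seq T) : finite_set [set x | List.In x s].
Proof.
elim: s => [|x s IH]; first by rewrite (_ : mkset _ = set0) //; apply/seteqP; split.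
rewrite (_ : mkset _ = [set x] `|` [set x | List.In x s]).
  by rewrite finite_setU; split=> //; apply: finite_set1.
by apply/seteqP; split=> y /= [->|]; [left|right|left|right].
Qed.

Lemma In_pmap_id T (x : T) s : List.In (Some x) s -> List.In x (pmap id s).
Proof.
by elim: s => //= -[y|] s IH /= []; [case=> ->; left|move/IH; right|by []|move/IH].
Qed.

Lemma In_map T U (f : T -> U) s y : List.In y (map f s) <-> exists2 x, List.In x s & f x = y.
Proof.
elim: s => [|x s IH] /=; first by split=> // -[].
split=> [[<-|/IH[z zs <-]]|[z [->|zs] fz]]; first by exists x => //; left.
- by exists z => //; right.
- by left.
- by right; apply/IH; exists z.
Qed.

Lemma In_choice T U (R : T -> U -> Prop) (s : seq U) : (forall y, List.In y s -> exists x, R x y) ->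
  exists t, (forall x, List.In x t -> exists2 y, List.In y s & R x y) /\
            (forall y, List.In y s -> exists2 x, List.In x t & R x y).
Proof.
elim: s => [|y s IH] h; first by exists [::].
have [|t [t1 t2]] := IH; first by move=> z zs; apply: h; right.
have [|x xy] := h y; first by left.
exists (x :: t); split=> z [<-|].
- by exists y => //; left.
- by move=> /t1[w ws]; exists w => //; right.
- by exists x => //; left.
- by move=> /t2[w ws]; exists w => //; right.
Qed.

Section Formulas.
Variable L : language.

Fixpoint rename V W (u : V -> W) (f : formula L V) : formula L W :=
  match f with
  | Rel _ R t => Rel R (map_tuple u t)
  | Eq x y => Eq L (u x) (u y)
  | Bot => Bot
  | Imp f g => Imp (rename u f) (rename u g)
  | All f => All (rename (omap u) f)
  end.

Fixpoint fv V (f : formula L V) : seq V :=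
  match f with
  | Rel _ R t => t
  | Eq x y => [:: x; y]
  | Bot => [::]
  | Imp f g => fv f ++ fv g
  | All f => pmap id (fv f)
  end.

Lemma map_tuple_ext n V W (t : n.-tuple V) (u w : V -> W) :
  (forall x, List.In x t -> u x = w x) -> map_tuple u t = map_tuple w t.
Proof.
move=> uw; apply: val_inj => /=; elim: (val t) uw => //= x s IH uw.
by rewrite uw ?IH //; [move=> y ys; apply: uw; right|left].
Qed.

Lemma map_tuple_comp n V W X (t : n.-tuple V) (u : V -> W) (w : W -> X) :
  map_tuple w (map_tuple u t) = map_tuple (w \o u) t.
Proof. by apply: val_inj => /=; rewrite map_comp. Qed.

Lemma sat_rename (M : structure L) V W (u : V -> W) (f : formula L V) (v : W -> M) :
  sat (rename u f) v <-> sat f (v \o u).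
Proof.
elim: f W u v => //= [V' n R t|V' f IHf g IHg|V' f IH] W u v.
- by rewrite map_tuple_comp.
- by rewrite IHf IHg.
- have E a : oapp v a \o omap u = oapp (v \o u) a by apply/funext; case.
  by split=> h a; [rewrite -E -IH|rewrite IH E].
Qed.

Lemma sat_agree (M : structure L) V (f : formula L V) (v w : V -> M) :
  (forall x, List.In x (fv f) -> v x = w x) -> sat f v <-> sat f w.
Proof.
elim: f v w => //= [V' n R t|V' x y|V' f IHf g IHg|V' f IH] v w vw.
- by rewrite (map_tuple_ext vw).
- by rewrite !vw //; [right; left|left].
- by rewrite (IHf v w) ?(IHg v w) // => x xs; apply: vw; apply/In_cat; [right|left].
- have E a : sat f (oapp v a) <-> sat f (oapp w a).
    by apply: IH => -[x|] //= xs; apply: vw (In_pmap_id xs).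
  by split=> h a; apply/E.
Qed.

Lemma rename_agree V W (f : formula L V) (v w : V -> W) :
  (forall x, List.In x (fv f) -> v x = w x) -> rename v f = rename w f.
Proof.
elim: f W v w => //= [V' n R t|V' x y|V' f IHf g IHg|V' f IH] W v w vw.
- by rewrite (map_tuple_ext vw).
- by rewrite !vw //; [right; left|left].
- by rewrite (IHf _ v w) ?(IHg _ v w) // => x xs; apply: vw; apply/In_cat; [right|left].
- by congr All; apply: IH => -[x|] //= xs; rewrite (vw _ (In_pmap_id xs)).
Qed.

Lemma rename_comp V W X (u : V -> W) (w : W -> X) (f : formula L V) :
  rename w (rename u f) = rename (w \o u) f.
Proof.
elim: f W X u w => //= [V' n R t|V' f IHf g IHg|V' f IH] W X u w.
- by rewrite map_tuple_comp.
- by rewrite IHf IHg.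
- by rewrite IH; congr All; apply: rename_agree => -[].
Qed.

Lemma rename_id V (f : formula L V) : rename id f = f.
Proof.
elim: f => //= [V' n R t|V' f IHf g IHg|V' f IH].
- by congr Rel; apply: val_inj; rewrite /= map_id.
- by rewrite IHf IHg.
- by rewrite -{2}IH; congr All; apply: rename_agree => -[].
Qed.

Lemma fv_rename V W (u : V -> W) (f : formula L V) y :
  List.In y (fv (rename u f)) -> exists2 x, List.In x (fv f) & u x = y.
Proof.
elim: f W u y => //= [V' n R t|V' x z|V' f IHf g IHg|V' f IH] W u y.
- by move=> /In_map.
- by case=> [<-|[<-|//]]; [exists x|exists z] => //; [left|right; left].
- move=> /In_cat[] h; [have [x xs <-] := IHf _ _ _ h|have [x xs <-] := IHg _ _ _ h];
    exists x => //; apply/In_cat; by [left|right].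
- have pmapP s : List.In y (pmap id s) -> List.In (Some y) s.
    by elim: s => //= -[z|] s IHs /=; [case=> [->|/IHs]; [left|right]|right; apply: IHs].
  by move=> /pmapP h; have [[x|] //= xs [<-]] := IH _ _ _ h; exists x => //; apply: In_pmap_id.
Qed.

Lemma rename_inj V W (x0 : V) (u : V -> W) : injective u -> injective (@rename V W u).
Proof.
move=> uI f g.
have [w wK] : exists w : W -> V, forall x, w (u x) = x.
  exists (fun y => if pselect (exists x, u x = y) is left h then projT1 (cid h) else x0).
  move=> x; case: pselect => [h|[]]; last by exists x.
  by case: cid => z /= /uI.
have E h : rename w (rename u h) = h.
  by rewrite rename_comp -[RHS]rename_id; apply: rename_agree => x _ /=; rewrite wK.
by move=> /(congr1 (rename w)); rewrite !E.
Qed.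

Definition And V (f g : formula L V) := Not (Imp f (Not g)).
Definition Ex V (f : formula L (option V)) := Not (All (Not f)).
Definition conj V (s : seq (formula L V)) := foldr (@And V) (Imp Bot Bot) s.

Lemma sat_Not (M : structure L) V (f : formula L V) (v : V -> M) : sat (Not f) v <-> ~ sat f v.
Proof. by []. Qed.

Lemma sat_And (M : structure L) V (f g : formula L V) (v : V -> M) :
  sat (And f g) v <-> sat f v /\ sat g v.
Proof.
rewrite /And /=; split=> [h|[hf hg]]; last by move=> /(_ hf hg).
split; apply: contrapT => n; apply: h => //.
Qed.

Lemma sat_Ex (M : structure L) V (f : formula L (option V)) (v : V -> M) :
  sat (Ex f) v <-> exists a, sat f (oapp v a).
Proof.
rewrite /Ex /=; split=> [h|[a fa]]; last by move=> /(_ a fa).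
by apply: contrapT => n; apply: h => a fa; apply: n; exists a.
Qed.

Lemma sat_conj (M : structure L) V (s : seq (formula L V)) (v : V -> M) :
  sat (conj s) v <-> forall f, List.In f s -> sat f v.
Proof.
elim: s => [|f s IH]; first by split=> [_ f []|_ []].
rewrite (_ : conj (f :: s) = And f (conj s)) // sat_And IH; split=> [[hf hs] g [<-//|/hs//]|h].
by split=> [|g gs]; apply: h; [left|right].
Qed.

Definition idx V (s : seq V) (x : V) : nat := find (fun y => `[< y = x >]) s.

Lemma nth_idx V (s : seq V) x0 x : List.In x s -> nth x0 s (idx s x) = x.
Proof.
rewrite /idx; elim: s => //= y s IH; case: asboolP => //= yx [//|/IH//].
Qed.

Lemma idx_lt V (s : seq V) x : List.In x s -> (idx s x < size s)%N.
Proof.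
rewrite /idx; elim: s => //= y s IH; case: asboolP => //= yx [//|/IH//].
Qed.

Lemma rename_nth V (s : seq V) x0 (f : formula L V) :
  (forall x, List.In x (fv f) -> List.In x s) ->
  rename (nth x0 s) (rename (idx s) f) = f.
Proof.
move=> fs; rewrite rename_comp -[RHS]rename_id; apply: rename_agree => x /fs xs /=.
exact: nth_idx.
Qed.

(** A formula is recovered from its pattern, with variables replaced by their positions, and the
    list of its variables. *)
Lemma inj_le_formula V : V -> inj_le (formula L V) (formula L nat * seq V).
Proof.
move=> x0; exists (fun f => (rename (idx (fv f)) f, fv f)) => f g [fg sfg].
by rewrite -(@rename_nth _ (fv f) x0 f) // fg sfg rename_nth.
Qed.

Lemma inj_lt_formula K V : V -> inj_lt (formula L nat) K -> inj_lt nat K ->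
  inj_lt V K -> inj_lt (formula L V) K.
Proof.
move=> x0 fK nK VK; apply: inj_le_lt_trans (inj_le_formula x0) _.
by apply: inj_lt_prod => //; apply: inj_lt_seq.
Qed.

End Formulas.

(** * Saturation for types in many variables *)

Definition sumv X Y Z (h : X -> Z) (e : Y -> Z) (u : X + Y) : Z :=
  match u with inl x => h x | inr y => e y end.

Definition fin_sat L (M : structure L) Q (e : Q -> M) (S : set (formula L (option Q))) :=
  forall s, (forall f, List.In f s -> S f) ->
    exists x, forall f, List.In f s -> sat f (oapp e x).

(* The one-variable form of saturation, with parameters named by a valuation. *)
Definition saturated1 (K : Type) L (M : structure L) : Prop :=
  forall (Q : Type) (e : Q -> M), inj_lt Q K -> forall S, fin_sat e S ->
    exists x, forall f, S f -> sat f (oapp e x).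

Lemma saturated_1 (K : cardinal) L (M : structure L) : saturated K M -> saturated1 K M.
Proof.
move=> Msat Q e QK S Sfin.
have eQ q : (range e) (e q) by exists q.
pose u (o : option Q) : 'I_1 + range e := if o is Some q then inr (toset (eQ q)) else inl ord0.
have uE (x : 1.-tuple M) o : oapp e (tnth x ord0) o =
    match u o with inl i => tnth x i | inr b => val b end by case: o.
have hE f (x : 1.-tuple M) : holds (rename u f : formula_over (range e) 1) x <->
    sat f (oapp e (tnth x ord0)).
  rewrite /holds sat_rename; apply: sat_agree => o _ /=; exact/esym/uE.
have rK : range e #< [set: K].
  by apply/card_ltTl; apply: inj_le_lt_trans QK; apply: inj_le_range.
have [|x xr] := Msat _ rK 1 [set rename u f | f in S].
  move=> r0 r0S /finite_setE[s r0s].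
  have [|t [t1 t2]] := @In_choice _ _ (fun f g => S f /\ rename u f = g) s.
    by move=> g /r0s/r0S[f Sf <-]; exists f.
  have [f|x xt] := Sfin t; first by move=> /t1[? ? []].
  exists [tuple x] => g /r0s/t2[f /xt fx [_ <-]]; apply/hE; exact: fx.
by exists (tnth x ord0) => f Sf; apply/hE; apply: xr; exists f.
Qed.

Lemma In_max W (lt : W -> W -> Prop) : is_wo lt -> forall (w0 : W) (s : seq W),
  exists m, List.In m (w0 :: s) /\ forall v, List.In v (w0 :: s) -> lt v m \/ v = m.
Proof.
move=> ltwo w0 s; elim: s w0 => [|w s IH] w0.
  by exists w0; split; [left|move=> v [<-|//]; right].
have [m [ms mm]] := IH w.
have [h|h|h] := wo_total ltwo w0 m.
- exists m; split; first by right.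
  by move=> v [<-|/mm//]; left.
- by exists m; split; [right|move=> v [<-|/mm//]; right].
- exists w0; split; first by left.
  move=> v [<-|/mm [vm|->]]; [by right|left|by left].
  exact: wo_trans vm h.
Qed.

Section Realize.
Variables (L : language) (M : structure L) (K V Q I : Type) (lt : V -> V -> Prop).
Variables (e : Q -> M) (U : set_system I) (H : I -> V -> M).
Hypotheses (Msat : saturated1 K M) (ltwo : is_wo lt) (m0 : M).
Hypothesis segK : forall v, inj_lt (seg lt v + Q) K.
Hypothesis Uult : UltraFilter U.

Let inseg (v : V) (u : seg lt v + Q) : V + Q :=
  match u with inl x => inl (val x) | inr q => inr q end.

Local Notation below h v := (sumv (fun u : seg lt v => h (val u)) e).

Let good (g : V -> M) (v : V) : Prop :=
  forall f : formula L (option (seg lt v + Q)),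
    U [set i | sat f (oapp (below (H i) v) (H i v))] ->
    sat f (oapp (below g v) (g v)).

(** The variables from [V] in [F] have a greatest one, [m], so [F] is a formula about the value at
    [m] over the values below it, and goodness at [m] applies. *)
Let good_sat (g : V -> M) (F : formula L (V + Q)) :
  (forall v, List.In (inl v) (fv F) -> good g v) ->
  U [set i | sat F (sumv (H i) e)] -> sat F (sumv g e).
Proof.
move=> Fg UF.
pose s := pmap (fun u : V + Q => if u is inl v then Some v else None) (fv F).
have sP v : List.In v s <-> List.In (inl v) (fv F).
  rewrite /s; elim: (fv F) => //= -[w|q] t IH /=; rewrite IH; split.
  - by case=> [->|h]; [left|right].
  - by case=> [[->]|h]; [left|right].
  - by right.
  - by case.
(* Without variables from [V] the truth value of [F] is constant, and a set in [U] is not empty. *)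
case: s sP => [|w s] sP.
  have [i] := filter_ex UF; apply: (iffLR _); apply: sat_agree => -[v|//] /sP [].
have [m [ms mmax]] := In_max ltwo w s.
pose r (u : V + Q) : option (seg lt m + Q) := match u with
  | inl v => if pselect (seg lt m v) is left p then Some (inl (toset p)) else None
  | inr q => Some (inr q) end.
have rE (h : V -> M) : sat (rename r F) (oapp (below h m) (h m)) <-> sat F (sumv h e).
  rewrite sat_rename; apply: sat_agree => -[v|q] //= /sP/mmax; case: pselect => //= n [//|->//].
apply/rE; apply: (Fg m); first exact/sP.
by apply: filterS UF => i /rE.
Qed.

(* [g v] realizes, over the previous values of [g], the limit along [U] of the
   types of the [H i v]. *)
Lemma realize_ultra : exists g : V -> M, forall F : formula L (V + Q),
  sat F (sumv g e) <-> U [set i | sat F (sumv (H i) e)].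
Proof.
(* [S] refers to the earlier values through every [k] compatible with their graph [r]; when [r] is
   the graph of [g] below [v], the only such [k] is the restriction of [g]. *)
pose S v (r : V -> M -> Prop) z := forall k : seg lt v -> M, (forall u, r (val u) (k u)) ->
  forall f : formula L (option (seg lt v + Q)),
    U [set i | sat f (oapp (below (H i) v) (H i v))] ->
    sat f (oapp (sumv k e) z).
have [g gS] := wf_choose S m0 (wo_wf ltwo).
have gg v : good g v.
  elim/(well_founded_ind (wo_wf ltwo)): v => v IH f Uf.
  apply: (gS v) => //; last by move=> u; split=> //; apply: (set_valP u).
  have [s sS|x xS] := @Msat _ (below g v) (@segK v)
      [set f | U [set i | sat f (oapp (below (H i) v) (H i v))]].
    (* The existence of a common solution is a formula about the earlier values, and these are good
       by induction. *)
    have Us : U [set i | sat (Ex (conj s)) (below (H i) v)].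
      have : U [set i | forall f, List.In f s ->
          sat f (oapp (below (H i) v) (H i v))].
        elim: s sS => [|f1 s IHs] sS; first by apply: filterS filterT => h _ f2 [].
        have U1 := sS f1 (or_introl erefl).
        have U2 := IHs (fun f2 fs => sS f2 (or_intror fs)).
        by apply: filterS (filterI U1 U2) => h [h1 h2] f2 [<-|/h2].
      by apply: filterS => i hs; apply/sat_Ex; exists (H i v); apply/sat_conj.
    have E h : sat (rename (@inseg v) (Ex (conj s))) (sumv h e) <->
        sat (Ex (conj s)) (below h v).
      by rewrite sat_rename; apply: sat_agree => -[u|q].
    have : sat (rename (@inseg v) (Ex (conj s))) (sumv g e).
      apply: good_sat; last by apply: filterS Us => h /E.
      move=> w h; have [[u|//] _ [<-]] := fv_rename h; apply: IH; exact: (set_valP u).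
    by move=> /E/sat_Ex[x /sat_conj xs]; exists x.
  exists x => k kr f' Uf'.
  have -> : k = (fun u => g (val u)) by apply/funext => u; have [_ ->] := kr u.
  exact: xS.
exists g => F; split=> [gF|]; last by apply: good_sat.
have [//|UF] := in_ultra_setVsetC [set i | sat F (sumv (H i) e)] Uult.
have : sat (Not F) (sumv g e) by apply: good_sat.
by move=> /(_ gF).
Qed.

End Realize.

(** The index set consists of the valuations themselves, and the ultrafilter contains, for each
    finite part of [S], the valuations that satisfy it. *)
Lemma realize_fin_sat (K : Type) L (M : structure L) (V Q : Type) (e : Q -> M)
    (S : set (formula L (V + Q))) :
  saturated1 K M -> inj_lt (V + Q) K -> M ->
  (forall s, (forall f, List.In f s -> S f) -> exists h : V -> M,
    forall f, List.In f s -> sat f (sumv h e)) ->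
  exists g : V -> M, forall f, S f -> sat f (sumv g e).
Proof.
move=> Msat VK m0 Sfin; have [lt ltwo] := well_orderable V.
pose B (s : seq (formula L (V + Q))) :=
  [set h : V -> M | forall f, List.In f s -> sat f (sumv h e)].
pose D := [set s : seq (formula L (V + Q)) | forall f, List.In f s -> S f].
have FF : ProperFilter (filter_from D B).
  apply: filter_from_proper; last by move=> s /Sfin.
  apply: filter_from_filter; first by exists [::].
  move=> s t sS tS; exists (s ++ t); first by move=> f /In_cat[/sS|/tS].
  by move=> h hst; split=> f fs; apply: hst; apply/In_cat; [left|right].
have [U [Uult FU]] := ultraFilterLemma FF.
have segK v : inj_lt (seg lt v + Q) K.
  apply: inj_le_lt_trans VK; exact: inj_le_sum (inj_le_set _) (inj_lexx _).
have [g gU] := realize_ultra e (fun h => h) Msat ltwo m0 segK Uult.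
exists g => f Sf; apply/gU/FU; exists [:: f] => [f' [<-|//]//|h]; apply; by left.
Qed.

Lemma holdsE L (M : structure L) (B : set M) n (f : formula_over B n) (x : n.-tuple M) :
  holds f x <-> sat f (sumv (tnth x) val).
Proof. by apply: sat_agree => -[]. Qed.

Lemma saturated_n (K : cardinal) L (M : structure L) :
  inj_lt nat K -> saturated1 K M -> M -> saturated K M.
Proof.
move=> nK Msat m0 B /card_ltTl BK n r rfin.
have nB : inj_lt ('I_n + B) K.
  apply: inj_lt_sum BK => //; apply: inj_le_lt_trans nK.
  by exists (@nat_of_ord n); apply: ord_inj.
have [s sr|g gr] := @realize_fin_sat K L M 'I_n B val r Msat nB m0.
  have [//|x xs] := rfin [set f | List.In f s] _ (In_finite_set s).
  by exists (tnth x) => f fs; apply/holdsE/xs.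
exists [tuple g i | i < n] => f rf; apply/holdsE.
apply: (iffLR _) (gr f rf); apply: sat_agree => -[i|b] //= _.
by rewrite tnth_mktuple.
Qed.

(** [x0] is put among the variables so that their number is positive, as quantifier elimination down
    to predicates requires. *)
Lemma finite_support L V (x0 : V) (F : formula L V) :
  exists k (t : 'I_k.+1 -> V) (f : formula L 'I_k.+1), t ord0 = x0 /\ F = rename t f.
Proof.
pose s := x0 :: fv F.
exists (size (fv F)), (fun i => nth x0 s i), (rename (fun v => inord (idx s v)) F).
split=> //; rewrite rename_comp -[LHS]rename_id; apply: rename_agree => v vF /=.
have vs : List.In v s by right.
by rewrite inordK ?nth_idx //; have := idx_lt vs.
Qed.

(** * Quantifiers over P and complete sets *)

Section ExistsInP.
Variables (L : language) (P : rel_symbol L 1) (C : structure L).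

Definition inP V (v : V) : formula L V := Rel P [tuple v].

Lemma sat_inP (M : structure L) V (x : V) (v : V -> M) : sat (inP x) v <-> Pset P M (v x).
Proof.
by rewrite /= /Pset /= (_ : map_tuple _ _ = [tuple v x]) //; apply: val_inj.
Qed.

Definition ExP V (f : formula L (option V)) := Ex (And (inP None) f).

Lemma sat_ExP (M : structure L) V (f : formula L (option V)) (v : V -> M) :
  sat (ExP f) v <-> exists2 a, Pset P M a & sat f (oapp v a).
Proof.
rewrite sat_Ex; split=> [[a /sat_And[/sat_inP Pa fa]]|[a Pa fa]]; exists a => //.
by apply/sat_And; split=> //; apply/sat_inP.
Qed.

Let out n Q (u : 'I_n.+1 + Q) : option ('I_n + Q) :=
  match u with
  | inl i => if unlift ord0 i is Some j then Some (inl j) else None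
  | inr q => Some (inr q)
  end.

Fixpoint ExPn n Q : formula L ('I_n + Q) -> formula L Q :=
  match n with
  | 0 => fun f => rename (fun u : 'I_0 + Q => match u with
      inl i => False_rect Q (notF (ltn_ord i)) | inr q => q end) f
  | n.+1 => fun f => ExPn (ExP (rename (@out n Q) f))
  end.

Let cons_val n (a : C) (x : 'I_n -> C) (i : 'I_n.+1) : C := oapp x a (unlift ord0 i).

Lemma sat_ExPn n Q (f : formula L ('I_n + Q)) (e : Q -> C) :
  sat (ExPn f) e <-> exists2 x : 'I_n -> C, (forall i, Pset P C (x i)) & sat f (sumv x e).
Proof.
elim: n f => [|n IH] f.
  rewrite /= sat_rename; split=> [h|[x _ h]]; last first.
    by apply: (iffLR _) h; apply: sat_agree => -[[]|].
  exists (fun i : 'I_0 => False_rect C (notF (ltn_ord i))) => [[]//|].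
  by apply: (iffLR _) h; apply: sat_agree => -[[]|].
have outE a (x : 'I_n -> C) u : oapp (sumv x e) a (out u) = sumv (cons_val a x) e u.
  by case: u => //= i; rewrite /cons_val; case: unlift.
rewrite [ExPn f]/= IH; split=> [[x Px /sat_ExP[a Pa]]|[x Px fx]].
  rewrite sat_rename => fa; exists (cons_val a x).
    by move=> i; rewrite /cons_val; case: unlift.
  by apply: (iffLR _) fa; apply: sat_agree => u _; exact: outE.
exists (fun i => x (lift ord0 i)) => [i|]; first exact: Px.
apply/sat_ExP; exists (x ord0); first exact: Px.
rewrite sat_rename; apply: (iffLR _) fx; apply: sat_agree => u _.
rewrite /comp outE; case: u => //= i; rewrite /cons_val.
by case: unliftP => [j ->|->].
Qed.

Variable (A : set C).

Lemma complete_tuple n (f : formula L ('I_n + A)) (x : 'I_n -> C) : complete_set P A ->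
  (forall i, Pset P C (x i)) -> sat f (sumv x val) ->
  exists2 y : 'I_n -> C, (forall i, (A `&` Pset P C) (y i)) & sat f (sumv y val).
Proof.
move=> Acomp Px fx; have [|y [yA yf]] := Acomp n f.
  exists [tuple x i | i < n]; split=> [i|]; first by rewrite tnth_mktuple.
  apply/holdsE; apply: (iffLR _) fx; apply: sat_agree => -[i|] //= _.
  by rewrite tnth_mktuple.
by exists (tnth y) => //; apply/holdsE.
Qed.

Lemma complete_1 (f : formula L (option A)) x : complete_set P A -> Pset P C x ->
  sat f (oapp val x) -> exists2 y, (A `&` Pset P C) y & sat f (oapp val y).
Proof.
move=> Acomp Px fx.
pose u (o : option A) : 'I_1 + A := if o is Some a then inr a else inl ord0.
have uE y : sat (rename u f) (sumv (fun=> y) val) <-> sat f (oapp val y).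
  by rewrite sat_rename; apply: sat_agree => -[].
have [||y yA yf] := @complete_tuple 1 (rename u f) (fun=> x) Acomp; [by []|exact/uE|].
exists (y ord0) => //; apply/uE; apply: (iffLR _) yf; apply: sat_agree => -[i|] //= _.
by rewrite ord1.
Qed.

(** Induction on the number of variables: the later variables are bound by quantifiers over [P], a
    value of the first is found in [A], and it then becomes a parameter. *)
Lemma complete_of_1 : (forall (f : formula L (option A)) x, Pset P C x ->
    sat f (oapp val x) -> exists2 y, (A `&` Pset P C) y & sat f (oapp val y)) ->
  complete_set P A.
Proof.
move=> h1.
suff h n (f : formula L ('I_n + A)) (x : 'I_n -> C) :
    (forall i, Pset P C (x i)) -> sat f (sumv x val) ->
    exists2 y : 'I_n -> C, (forall i, (A `&` Pset P C) (y i)) & sat f (sumv y val).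
  move=> n f [x [Px /holdsE fx]]; have [y yA yf] := h n f _ Px fx.
  exists [tuple y i | i < n]; split=> [i|]; first by rewrite tnth_mktuple.
  apply/holdsE; apply: (iffLR _) yf; apply: sat_agree => -[i|] //= _.
  by rewrite tnth_mktuple.
elim: n f x => [|n IH] f x Px fx.
  exists (fun i : 'I_0 => False_rect C (notF (ltn_ord i))) => [[]//|].
  by apply: (iffLR _) fx; apply: sat_agree => -[[]|].
pose mv (u : 'I_n.+1 + A) : 'I_n + option A := match u with
  | inl i => if unlift ord0 i is Some j then inl j else inr None
  | inr a => inr (Some a) end.
have mvE a (y : 'I_n -> C) :
    sat (rename mv f) (sumv y (oapp val a)) <-> sat f (sumv (cons_val a y) val).
  rewrite sat_rename; apply: sat_agree => -[i|b] //= _.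
  by rewrite /cons_val; case: unlift.
have [||a [Aa Pa] /sat_ExPn[y Py /mvE fy]] := h1 (ExPn (rename mv f)) (x ord0).
- exact: Px.
- apply/sat_ExPn; exists (fun i => x (lift ord0 i)) => [i|]; first exact: Px.
  apply/mvE; apply: (iffLR _) fx; apply: sat_agree => -[i|] //= _.
  by rewrite /cons_val; case: unliftP => [j ->|->].
pose sb (u : 'I_n.+1 + A) : 'I_n + A := match u with
  | inl i => if unlift ord0 i is Some j then inl j else inr (toset Aa)
  | inr a => inr a end.
have sbE (z : 'I_n -> C) :
    sat (rename sb f) (sumv z val) <-> sat f (sumv (cons_val a z) val).
  rewrite sat_rename; apply: sat_agree => -[i|b] //= _.
  by rewrite /cons_val; case: unlift.
have [||z zA /sbE zf] := IH (rename sb f) y => //; first exact/sbE.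
by exists (cons_val a z) => // i; rewrite /cons_val; case: unlift => /=.
Qed.

End ExistsInP.

(** * Compactness of the part of a complete set in P *)

Definition Iff L V (f g : formula L V) := And (Imp f g) (Imp g f).

Lemma sat_Iff L (M : structure L) V (f g : formula L V) (v : V -> M) :
  sat (Iff f g) v <-> (sat f v <-> sat g v).
Proof. by rewrite sat_And /=; split=> -[? ?]; split. Qed.

Lemma sat_Imp L (M : structure L) V (f g : formula L V) (v : V -> M) :
  sat (Imp f g) v <-> (sat f v -> sat g v).
Proof. by []. Qed.

(** Here formulas are evaluated in [C] and have parameters in all of [A], whereas compactness of the
    substructure on the P-part of [A] concerns parameters and truth inside that substructure. *)
Definition P_compact (lam : Type) L (P : rel_symbol L 1) (C : structure L) (A : set C) :=
  forall S : set (formula L (option A)), inj_lt S lam ->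
  (forall s, (forall f, List.In f s -> S f) ->
     exists2 z, Pset P C z & forall f, List.In f s -> sat f (oapp val z)) ->
  exists2 z, (A `&` Pset P C) z & forall f, S f -> sat f (oapp val z).

Section Pcompact.
Variables (L : language) (P : rel_symbol L 1) (T : set (sentence L)) (C : structure L).
Hypotheses (CT : models C T) (hP : standing_assumptions P T C).
Variables (A : set C) (lam : cardinal).
Hypothesis Acomp : complete_set P A.

Let N := A `&` Pset P C.

Lemma Pset_nonempty : exists p, Pset P C p.
Proof. by have /infinite_setN0[p] := P_infinite hP CT; exists p. Qed.

Lemma trace_definable (f : formula L (option A)) :
  exists k (t : 'I_k.+1 -> 'I_1 + Pset P C) (g : formula L 'I_k.+1),
    forall z, Pset P C z ->
      (sat f (oapp val z) <-> sat g (fun i => sumv (fun=> z) val (t i))).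
Proof.
pose D := [set x : 1.-tuple C | Pset P C (tnth x ord0) /\ sat f (oapp val (tnth x ord0))].
have Ddef : definable [set: C] D.
  pose u (o : option A) : 'I_1 + [set: C] := if o is Some a
    then inr (toset (I : [set: C] (val a))) else inl ord0.
  exists (And (inP P (inl ord0)) (rename u f)); apply/seteqP.
  have E (x : 1.-tuple C) : D x <->
      holds (And (inP P (inl ord0)) (rename u f) : formula_over [set: C] 1) x.
    rewrite holdsE sat_And sat_inP sat_rename.
    have -> : sat f (sumv (tnth x) val \o u) <-> sat f (oapp val (tnth x ord0)).
      by apply: sat_agree => -[].
    by [].
  by split=> x /E.
have [x [Px _] i|f' Df'] := P_stably_embedded hP _ Ddef; first by rewrite ord1.
have [k [t [g [_ f'E]]]] := finite_support (inl ord0) f'.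
exists k, t, g => z Pz.
have -> : sat f (oapp val z) <-> D [tuple z] by split=> [h|[]].
rewrite Df' /= holdsE f'E sat_rename.
by apply: sat_agree => i _ /=; case: (t i) => // j; rewrite ord1.
Qed.

(* Stable embeddedness defines the trace of [f] on [P] with parameters in [P],
   completeness moves these into [N], and by quantifier elimination the
   definition is atomic, hence has the same meaning in the substructure [N]. *)
Lemma trace_atomic (f : formula L (option A)) :
  exists r : formula_over [set: substructure N] 1,
    forall z : N, holds r [tuple z] <-> sat f (oapp val (val z)).
Proof.
have [k [t [g gE]]] := trace_definable f.
have [p0 Pp0] := Pset_nonempty.
(* The parameters of the definition become variables [y]: the formula [G] over [A] says that [y]
   defines the trace of [f] on [P], and completeness finds such [y] in [N]. *)
pose zv (i : 'I_k.+1) : option ('I_k.+1 + A) := if t i is inr _ then Some (inl i) else None.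
pose G : formula L ('I_k.+1 + A) := All (Imp (inP P None)
  (Iff (rename (omap inr) f) (rename zv g))).
have GE (y : 'I_k.+1 -> C) : sat G (sumv y val) <-> forall z, Pset P C z ->
    (sat f (oapp val z) <-> sat g (fun i => if t i is inr _ then y i else z)).
  have E z : sat (Imp (inP P None) (Iff (rename (omap inr) f) (rename zv g)))
      (oapp (sumv y val) z) <-> (Pset P C z ->
    (sat f (oapp val z) <-> sat g (fun i => if t i is inr _ then y i else z))).
    rewrite sat_Imp sat_inP sat_Iff !sat_rename.
    rewrite (_ : sat f _ <-> sat f (oapp val z)); last by apply: sat_agree => -[].
    rewrite (_ : sat g _ <-> sat g (fun i => if t i is inr _ then y i else z)) //.
    by apply: sat_agree => i _; rewrite /zv /=; case: (t i).
  by split=> h z; [exact: (iffLR (E z) (h z))|exact: (iffRL (E z) (h z))].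
have [|| y yN /GE {}gE] := complete_tuple (f := G)
    (x := fun i => if t i is inr p then val p else p0) Acomp.
- by move=> i; case: (t i) => // p; apply: (set_valP p).
- apply/GE => z Pz; rewrite gE //; apply: sat_agree => i _.
  by case: (t i).
have [R RE] := QE_to_predicates hP g isT.
pose a i : 'I_1 + [set: substructure N] := if t i is inr _
  then inr (toset (I : [set: substructure N] (toset (yN i)))) else inl ord0.
exists (Rel R [tuple a i | i < k.+1]) => z.
rewrite gE; last by have [] := set_valP z.
rewrite /holds /=.
set w := map_tuple _ (map_tuple _ _).
have -> : interp R w <-> sat g (tnth w) by rewrite -RE.
apply: sat_agree => i _; rewrite /w !tnth_map tnth_ord_tuple /a.
by case: (t i).
Qed.

(** By completeness a finite part satisfied in [P] is satisfied in [N], where each formula can be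
    replaced by an atomic one with parameters in [N]. *)
Lemma P_compact_of_complete : compact_struct lam (substructure N) -> P_compact lam P A.
Proof.
move=> Nc S Slam Sfin; have [r rE] := choice trace_atomic.
have [||x xr] := Nc 1 [set r f | f in S].
- by apply/card_ltTl; apply: inj_le_lt_trans Slam; apply/inj_leP/card_image_le.
- move=> r0 r0S /finite_setE[s r0s].
  have [|s' [s1 s2]] := @In_choice _ _ (fun f g => S f /\ r f = g) s.
    by move=> g /r0s/r0S[f Sf <-]; exists f.
  have [f|z Pz zs] := Sfin s'; first by move=> /s1[? ? []].
  have [|z' z'N /sat_conj z's] := complete_1 (f := conj s') Acomp Pz.
    exact/sat_conj.
  exists [tuple toset z'N : N] => g /r0s/s2[f /z's fx [_ <-]]; apply/rE; exact: fx.
exists (val (tnth x ord0)) => [|f Sf]; first exact: (set_valP (tnth x ord0)).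
apply/rE; have -> : [tuple tnth x ord0] = x.
  by apply: eq_from_tnth => i; rewrite ord1.
by apply: xr; exists f.
Qed.

End Pcompact.

Lemma inj_le_formula_nat (L : language) : inj_le nat (formula L nat).
Proof. by exists (fun n => Eq L n n) => m n [->]. Qed.

(** * The tree of types *)

(* [Par w x] names the parameters of the splitting formula at the node [x] of
   level [w], [Wit w x th c] a witness in [P] for the formula [th] with
   parameters [c], and [Sk f n c] a value of a Skolem function. *)
Section Terms.
Variables (L : language) (W X : Type).

Inductive term :=
| Par (w : W) (x : X) (j : nat)
| Wit (w : W) (x : X) (th : formula L (option (option nat))) (c : nat -> term)
| Sk (f : formula L (option nat)) (n : nat) (c : nat -> term).

Let label := ((W * X * nat) + ((W * X * formula L (option (option nat))) +
  (formula L (option nat) * nat)))%type.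

Let lab (t : term) : label := match t with
  | Par w x j => inl (w, x, j)
  | Wit w x th _ => inr (inl (w, x, th))
  | Sk f n _ => inr (inr (f, n)) end.

(** A term is a well-founded tree branching over [nat], determined by the labels along its finite
    paths. With labels coded as subsets of [K] it becomes a set of pairs of a path and an element of
    [K]. *)
Lemma inj_le_term K : inj_le nat K -> inj_le (formula L nat) (set K) ->
  inj_le W (set K) -> inj_le X (set K) -> inj_le term (set K).
Proof.
move=> nK LK WK XK.
have nsK : inj_le nat (set K).
  by apply: inj_le_trans nK _; exists (fun k => [set k]) => a b /seteqP[/(_ a erefl)].
have prodK Y Z : inj_le Y (set K) -> inj_le Z (set K) -> inj_le (Y * Z) (set K).
  by move=> h1 h2; apply: inj_le_trans (inj_le_square nsK); apply: inj_le_prod.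
have sumK Y Z : inj_le Y (set K) -> inj_le Z (set K) -> inj_le (Y + Z) (set K).
  by move=> h1 h2; apply: inj_le_trans (inj_le_sumX nsK); apply: inj_le_sum.
have on : inj_le (option nat) nat by exists pickle; apply: pcan_inj (@pickleK (option nat)).
have oon : inj_le (option (option nat)) nat.
  by exists pickle; apply: pcan_inj (@pickleK (option (option nat))).
have fK V : V -> inj_le V nat -> inj_le (formula L V) (set K).
  by move=> v0 [u uI]; apply: inj_le_trans LK; exists (rename u); apply: rename_inj.
have [j jI] : inj_le label (set K).
  apply: (sumK); first by apply: (prodK) => //; apply: (prodK).
  apply: (sumK); last by apply: (prodK) => //; apply: fK => //; exact: None.
  by apply: (prodK); [apply: (prodK)|apply: fK => //; exact: None].
have pK : inj_le (seq nat * K) K.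
  apply: inj_le_trans (inj_le_square nK); apply: inj_le_prod (inj_lexx _).
  exact: inj_le_trans (inj_le_seq (inj_lexx _)) nK.
apply: inj_le_trans (inj_le_set_mono pK).
pose enc := fix enc (t : term) (p : seq nat) (k : K) {struct t} : Prop :=
  match p with
  | [::] => j (lab t) k
  | i :: q => match t with
    | Par _ _ _ => False
    | Wit _ _ _ c => enc (c i) q k
    | Sk _ _ c => enc (c i) q k end
  end.
have encE t s : enc t = enc s -> lab t = lab s.
  have e0 u : enc u [::] = j (lab u) by case: u.
  by move=> /(congr1 (fun e => e [::])); rewrite !e0 => /jI.
exists (fun t p => enc t p.1 p.2) => t s ts.
have {}ts : enc t = enc s.
  by apply/funext => p; apply/funext => k; have /(congr1 (fun e => e (p, k))) := ts.
elim: t s ts => [w x n|w x th c IH|f n c IH] s ts; have := encE _ _ ts;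
  case: s ts => [w' x' n'|w' x' th' c'|f' n' c'] ts //=.
- by case=> -> -> ->.
- case=> -> -> ->; congr Wit; apply/funext => i; apply: IH.
  by apply/funext => p; have /(congr1 (fun e => e (i :: p))) := ts.
- case=> -> ->; congr Sk; apply/funext => i; apply: IH.
  by apply/funext => p; have /(congr1 (fun e => e (i :: p))) := ts.
Qed.

Variable lt : W -> W -> Prop.

(** Bounds the levels at which [eval] reads the valuation: a [Wit] term is read as a whole, without
    entering its arguments, and of the arguments of [Sk] only the first [n] count. *)
Fixpoint below (w : W) (t : term) : Prop :=
  match t with
  | Par v _ _ => lt v w
  | Wit v _ _ _ => lt v w
  | Sk _ n c => forall i, (i < n)%N -> below w (c i)
  end.

Lemma below_trans v w t : is_wo lt -> lt v w -> below v t -> below w t.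
Proof.
move=> ltwo vw; elim: t => [u x j uv|u x th c _ uv|f n c IH h i /h/IH//]; exact: wo_trans uv vw.
Qed.

Lemma below_bound (w0 : W) t : is_wo lt -> (forall w, exists w', lt w w') -> exists w, below w t.
Proof.
move=> ltwo nomax; elim: t => [u x j|u x th c _|f n c IH]; do ?exact: nomax.
elim: n => [|n [w wn]]; first by exists w0.
have [v vn] := IH n.
have [u] := wo_list_bound ltwo nomax w0 [:: v; w].
move=> h; exists u => i; rewrite ltnS leq_eqVlt => /orP[/eqP->|/wn].
  by apply: below_trans vn => //; apply: h; left.
by apply: below_trans => //; apply: h; right; left.
Qed.

Lemma below_bound_seq (w0 : W) s : is_wo lt -> (forall w, exists w', lt w w') ->
  exists w, forall t, List.In t s -> below w t.
Proof.
move=> ltwo nomax; elim: s => [|t s [w ws]]; first by exists w0.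
have [v vt] := below_bound w0 t ltwo nomax.
have [u h] := wo_list_bound ltwo nomax w0 [:: v; w].
exists u => t' [<-|/ws]; first by apply: below_trans vt => //; apply: h; left.
by apply: below_trans => //; apply: h; right; left.
Qed.

Section Eval.
Variables (Y : Type) (y0 : Y) (skolem : formula L (option nat) -> (nat -> Y) -> Y).

(** The valuation [b] matters at [Par] and [Wit] terms only; the Skolem functions force the rest.
    Arguments from the [n]-th on are replaced by [y0], so that every term depends on levels below
    some bound. *)
Fixpoint eval (b : term -> Y) (t : term) : Y :=
  match t with
  | Sk f n c => skolem f (fun i => if (i < n)%N then eval b (c i) else y0)
  | _ => b t
  end.

Lemma eval_below w b b' t : (forall u, below w u -> b u = b' u) ->
  below w t -> eval b t = eval b' t.
Proof.
move=> bb'; elim: t => [u x j|u x th c _|f n c IH] h; [exact: (bb' _ h)|exact: (bb' _ h)|].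
rewrite /=; congr (skolem f _); apply/funext => i; case: ifP => // ilt.
exact/IH/h.
Qed.

End Eval.
End Terms.

Lemma In_filter T (p : pred T) s x : List.In x (seq.filter p s) <-> List.In x s /\ p x.
Proof.
elim: s => [|y s IH] /=; first by split=> // -[].
case: ifP => py /=; rewrite IH; split.
- by case=> [<-|[]]; [split; [left|]|split; [right|]].
- by case=> -[->|]; [left|right].
- by case=> ? ?; split; [right|].
- by case=> -[yx|//]; rewrite -yx py.
Qed.

Lemma inj_le_In V (x0 : V) (s : seq V) : inj_le [set x | List.In x s] nat.
Proof.
apply: (inj_le_surj (f := nth x0 s)) => x xs; exists (idx s x); exact: nth_idx.
Qed.

(* In [th], the variable [None] ranges over [P] and [Some None] is the variable
   of the type. *)
Definition closing L (P : rel_symbol L 1) Q (th : formula L (option (option Q))) (b : Q) :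
    formula L (option Q) :=
  Imp (ExP P th) (rename (fun o => if o is Some u then u else Some b) th).

Lemma sat_closing L (P : rel_symbol L 1) (M : structure L) Q
    (th : formula L (option (option Q))) (b : Q) (e : Q -> M) x :
  sat (closing P th b) (oapp e x) <->
  ((exists2 z, Pset P M z & sat th (oapp (oapp e x) z)) ->
   sat th (oapp (oapp e x) (e b))).
Proof.
rewrite /closing sat_Imp sat_ExP sat_rename.
suff -> : sat th (oapp e x \o (fun o => if o is Some u then u else Some b)) <->
  sat th (oapp (oapp e x) (e b)) by [].
by apply: sat_agree => -[].
Qed.

(** * Small consistent types and witnesses in P *)

Section Extension.
Variables (L : language) (P : rel_symbol L 1) (C : structure L) (A : set C).
Variable r : set (formula L (option A)).

(** [r] is the small type and [s] a finite extension of it; consistency is expressed by a common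
    realization in [C]. *)
Definition realized_with (s : seq (formula L (option A))) : Prop :=
  exists x : C, (forall f, r f -> sat f (oapp val x)) /\
                (forall f, List.In f s -> sat f (oapp val x)).

Lemma realized_withS s t : (forall f, List.In f s -> List.In f t) ->
  realized_with t -> realized_with s.
Proof. by move=> st [x [xr xt]]; exists x; split=> // f /st/xt. Qed.

(** Let [z0] be a witness at a realization of the type. The formulas saying of [z] that some [x]
    satisfies [th] with it and a given finite part of the type are fewer than [lam] and hold at
    [z0]. Compactness gives one [b] in [A] for all of them, and saturation of [C] a realization with
    witness [b]. *)
Lemma realized_with_closing (kappa lam : Type) s (th : formula L (option (option A))) :
  saturated1 kappa C -> inj_lt A kappa -> inj_lt nat lam -> inj_lt r lam ->
  P_compact lam P A -> (exists a : A, Pset P C (val a)) ->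
  realized_with s ->
  exists2 b : A, Pset P C (val b) & realized_with (closing P th b :: s).
Proof.
move=> Csat Ak nl rl PA [a0 Pa0] [c [cr cs]].
have [[z0 Pz0 thz0]|nz] :=
    pselect (exists2 z, Pset P C z & sat th (oapp (oapp val c) z)); last first.
  (* No witness exists at [c], so the closing formula holds there vacuously and any point of [P] in
     [A] will do. *)
  exists a0 => //; exists c; split=> // f [<-|/cs//].
  by apply/sat_closing => h; case: nz.
pose R := r `|` [set f | List.In f s].
have Rl : inj_lt R lam.
  apply: inj_le_lt_trans (inj_le_setU _ _) _; apply: inj_lt_sum => //.
  by apply: inj_le_lt_trans nl; apply: inj_le_In Bot _.
have cR f : R f -> sat f (oapp val c) by case=> [/cr|/cs].
pose sw (u : option (option A)) : option (option A) := match u with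
  | None => Some None | Some None => None | Some (Some a) => Some (Some a) end.
pose F s' := Ex (And (rename sw th) (conj (map (rename (omap Some)) s'))) : formula L (option A).
have FE s' z : sat (F s') (oapp (val : A -> C) z) <-> exists x, sat th (oapp (oapp val x) z) /\
    forall f, List.In f s' -> sat f (oapp val x).
  have E x : sat (And (rename sw th) (conj (map (rename (omap Some)) s')))
      (oapp (oapp (val : A -> C) z) x) <-> sat th (oapp (oapp val x) z) /\
      forall f, List.In f s' -> sat f (oapp val x).
    have E1 : sat (rename sw th) (oapp (oapp (val : A -> C) z) x) <->
        sat th (oapp (oapp (val : A -> C) x) z).
      by apply: iff_trans (sat_rename _ _ _) _; apply: sat_agree => -[[]|].
    have E2 f : sat (rename (omap Some) f) (oapp (oapp (val : A -> C) z) x) <->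
        sat f (oapp (val : A -> C) x).
      by apply: iff_trans (sat_rename _ _ _) _; apply: sat_agree => -[].
    split=> [/sat_And[/E1 h1 /sat_conj h2]|[h1 h2]].
      by split=> // f fs; apply/E2/h2/In_map; exists f.
    by apply/sat_And; split; [exact/E1|apply/sat_conj => f /In_map[g gs <-]; apply/E2/h2].
  rewrite /F sat_Ex; split=> -[x]; [move/E|move=> h]; exists x => //.
  exact/E.
have [|s' s'F|b [Ab Pb] bF] := PA [set F s' | s' in [set s' | forall f, List.In f s' -> R f]].
- have RR : inj_lt (seq R) lam by exact: inj_lt_seq.
  apply: inj_le_lt_trans RR; apply: (inj_le_surj (f := fun l : seq R => F (map val l))).
  move=> _ [s' s'R <-]; suff [l <-] : exists l : seq R, map val l = s' by exists l.
  elim: s' s'R => [|f s' IH] s'R; first by exists [::].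
  have [|l lE] := IH; first by move=> g gs; apply: s'R; right.
  by exists (toset (s'R f (or_introl erefl)) :: l); rewrite /= lE.
- exists z0 => // f /s'F[t tR <-]; apply/FE; exists c; split=> // g /tR; exact: cR.
exists (toset Ab) => //.
pose th' : formula L (option A) := rename (fun o => if o is Some u then u else Some (toset Ab)) th.
have th'E x : sat th' (oapp val x) <-> sat th (oapp (oapp val x) b).
  by rewrite sat_rename; apply: sat_agree => -[].
have [|t tS|x xS] := @Csat A val _ (R `|` [set th']); first exact: Ak.
  have [|x [xb xt]] := iffLR (FE (seq.filter (fun f => `[< R f >]) t) b) _.
    by apply: bF; exists (seq.filter (fun f => `[< R f >]) t) => // f /In_filter[_ /asboolP].
  exists x => f ft; have [Rf|->] := tS f ft; last exact/th'E.
  by apply: xt; apply/In_filter; split=> //; apply/asboolP.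
exists x; split=> [f rf|f [<-|fs]]; first by apply: xS; left; left.
  by apply/sat_closing => _; apply/th'E/xS; right.
by apply: xS; left; right.
Qed.

End Extension.

Section Adjoin.
Variables (L : language) (P : rel_symbol L 1) (C : structure L) (Q : Type).
Variables (g : Q -> C) (c : C).
Hypothesis closed : forall F : formula L (option (option Q)),
  (exists2 z, Pset P C z & sat F (oapp (oapp g c) z)) ->
  exists q, Pset P C (g q) /\ sat F (oapp (oapp g c) (g q)).

Let D := range g `|` range (tnth [tuple c]).

Let adjoin_closed (f : formula L (option D)) z : Pset P C z -> sat f (oapp val z) ->
  exists2 y, (range g `&` Pset P C) y & sat f (oapp val y).
Proof.
have Dc (d : D) : exists o : option Q, oapp g c o = val d.
  by case: (set_valP d) => [[t _ <-]|[i _ <-]];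
    [exists (Some t)|exists None; rewrite (tnth_nth c) ord1].
have [rho rhoP] := choice Dc.
move=> Pz fz; have E y : sat (rename (omap rho) f) (oapp (oapp g c) y) <->
    sat f (oapp val y).
  by rewrite sat_rename; apply: sat_agree => -[d|] //= _; rewrite rhoP.
have [|t [Pt /E ft]] := closed (F := rename (omap rho) f).
  by exists z => //; apply/E.
by exists (g t) => //; split=> //; exists t.
Qed.

Lemma adjoin_complete : complete_set P D.
Proof.
apply: complete_of_1 => f z Pz /(adjoin_closed Pz)[y [Ay Py] fy].
by exists y => //; split=> //; left.
Qed.

(** Closure is applied to the equation between a variable over [P] and the given point, which puts
    this point in the range of [g]. *)
Lemma adjoin_P : Pset P C `&` D = Pset P C `&` range g.
Proof.
apply/seteqP; split=> [z [Pz Dz]|z [Pz Az]]; last by split=> //; left.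
have [|y [Ay _] /= zy] := @adjoin_closed (Eq L None (Some (toset Dz))) z Pz; first by [].
by split=> //; rewrite -[z]zy.
Qed.

End Adjoin.

Lemma rename_closing L (P : rel_symbol L 1) Q R (u : Q -> R) th b :
  rename (omap u) (closing P th b) = closing P (rename (omap (omap u)) th) (u b).
Proof.
rewrite /closing /= !rename_comp; congr (Imp (Not (All (Not (And _ _)))) _).
- by congr Rel; apply: val_inj.
- by apply: rename_agree => -[].
Qed.

Lemma size_filter_lt T (p : pred T) s t : List.In t s -> ~~ p t ->
  (size (seq.filter p s) < size s)%N.
Proof.
elim: s => //= u s IH [->|ts] pt; first by rewrite (negbTE pt) ltnS size_filter count_size.
by case: ifP => _ /=; rewrite ?ltnS; [|apply: ltnW]; apply: IH.
Qed.

(** * Finite parts of the tree over A *)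

Section Tasks.
Variables (L : language) (P : rel_symbol L 1) (W X : Type) (lt : W -> W -> Prop).
Variables (node : W -> set W -> X) (psi : formula L (option nat)).
Local Notation term := (term L W X).

(* The requirements on the types along the branches: to split at level [w], and to
   have a witness for [th]. *)
Inductive task :=
| TSplit (w : W)
| TWit (w : W) (th : formula L (option (option nat))) (c : nat -> term).

Definition level (t : task) : W := match t with TSplit w => w | TWit w _ _ => w end.

(** A witness task only involves parameters settled at earlier levels; any finite list of terms
    meets this condition at a high enough level. *)
Definition valid (t : task) : Prop :=
  match t with TSplit _ => True | TWit w _ c => forall i, below lt w (c i) end.

(** Parameters and witnesses are named by nodes, so branches through a node share them; only the
    sign of the splitting formula depends on [eta w] itself. *)
Definition form (eta : set W) (t : task) : formula L (option term) :=
  match t with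
  | TSplit w =>
      let f := rename (omap (Par L w (node w eta))) psi in
      if `[< eta w >] then f else Not f
  | TWit w th c =>
      closing P (rename (omap (omap c)) th) (Wit w (node w eta) th c)
  end.

Hypothesis ltwo : is_wo lt.
Hypothesis nodeP : forall w A B,
  node w A = node w B <-> (forall v, lt v w -> A v <-> B v).

(** The formula of such a task depends on [eta] below [m] only; the splitting task of level [m] is
    left out because its sign is the value of [eta] at [m]. *)
Let before (m : W) (t : task) : Prop :=
  lt (level t) m \/ (level t = m /\ if t is TWit _ _ _ then True else False).

Let form_local m eta eta' t : (forall v, lt v m -> eta v <-> eta' v) ->
  before m t -> form eta t = form eta' t.
Proof.
move=> ee bt; have tm v : lt v (level t) -> lt v m.
  by move=> vt; case: bt => [tm|[<- //]]; exact: wo_trans vt tm.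
case: t bt tm => [w|w th c] /= bt tm; have -> : node w eta = node w eta'.
- by apply/nodeP => v /tm/ee.
- case: bt => [wm|[]//]; suff -> : `[< eta w >] = `[< eta' w >] by [].
  by congr asbool; apply/propext/ee.
- by apply/nodeP => v /tm/ee.
- by [].
Qed.

Section Branches.
Variables (C : structure L) (A : set C) (r : set (formula L (option A))).
Variables (a0 : A) (skolem : formula L (option nat) -> (nat -> A) -> A).

Definition ev (b : term -> A) (f : formula L (option term)) : formula L (option A) :=
  rename (omap (eval a0 skolem b)) f.

Lemma ev_split b w x : ev b (rename (omap (Par L w x)) psi) =
  rename (omap (fun j => b (Par L w x j))) psi.
Proof. by rewrite /ev rename_comp; apply: rename_agree => -[]. Qed.

Lemma ev_wit b w x th c : ev b (closing P (rename (omap (omap c)) th) (Wit w x th c)) =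
  closing P (rename (omap (omap (eval a0 skolem b \o c))) th) (b (Wit w x th c)).
Proof.
by rewrite /ev rename_closing rename_comp; congr closing; apply: rename_agree => -[[]|].
Qed.

Let ev_local b b' m eta t : valid t -> before m t ->
  (forall u, below lt m u -> b u = b' u) ->
  (if t is TWit w th c then forall x, b (Wit w x th c) = b' (Wit w x th c) else True) ->
  ev b (form eta t) = ev b' (form eta t).
Proof.
move=> vt bt bb' h; have tm u : below lt (level t) u -> below lt m u.
  by move=> ut; case: bt => [tm|[<- //]]; exact: below_trans tm ut.
case: t vt bt h tm => [w|w th c] /= vt bt h tm.
  have E : ev b (rename (omap (Par L w (node w eta))) psi) =
           ev b' (rename (omap (Par L w (node w eta))) psi).
    rewrite !ev_split; apply: rename_agree => -[j|] //= _; congr Some; apply: bb' => /=.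
    by case: bt => [|[]].
  by case: ifP => _ //; rewrite /ev /=; congr Imp; exact: E.
rewrite !ev_wit h; congr closing; apply: rename_agree => -[[i|]|] //= _.
by congr (Some (Some _)); apply: eval_below (vt i) => u /tm/bb'.
Qed.

Hypothesis r0 : realized_with r [::].
Hypothesis Pa0 : Pset P C (val a0).
Hypothesis splits : forall s, realized_with r s -> exists a : nat -> A,
  realized_with r (rename (omap a) psi :: s) /\
  realized_with r (Not (rename (omap a) psi) :: s).
Hypothesis closes : forall s th, realized_with r s ->
  exists2 b : A, Pset P C (val b) & realized_with r (closing P th b :: s).

Definition in_P (b : term -> A) : Prop :=
  forall w x th c, Pset P C (val (b (Wit w x th c))).

(* A task of maximal level is treated last, the splitting task of that level
   after the others.  The formulas of the other tasks then depend only on [eta]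
   below this level, and not on the value chosen for the last task. *)
Lemma branches_realized (ts : seq task) : (forall t, List.In t ts -> valid t) ->
  exists b, in_P b /\ forall eta, realized_with r (map (fun t => ev b (form eta t)) ts).
Proof.
have [n] := ubnP (size ts); elim: n => // n IH in ts *; rewrite ltnS => tsn tsv.
have [[ts0]|[t0 t0ts]] : ts = [::] \/ exists t0, List.In t0 ts.
- by case: (ts) => [|t s]; [left|right; exists t; left].
- by exists (fun=> a0); split=> // eta; rewrite ts0.
have [m [mts mmax]] : exists m, List.In m (map level ts) /\
    forall t, List.In t ts -> lt (level t) m \/ level t = m.
  have lin t : List.In t ts -> List.In (level t) (map level ts).
    by move=> h; apply/In_map; exists t.
  case: (map level ts) (lin) => [/(_ _ t0ts)//|w s] h.
  have [m [? mm]] := In_max ltwo w s; exists m; split=> // t /h; exact: mm.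
have [t [tts lt_t tsplit]] : exists t, [/\ List.In t ts, level t = m &
    List.In (TSplit m) ts -> t = TSplit m].
  have [h|h] := pselect (List.In (TSplit m) ts); first by exists (TSplit m).
  by have /In_map[t tts tm] := mts; exists t.
pose ts' := seq.filter (fun u => ~~ `[< u = t >]) ts.
have ts'P u : List.In u ts' -> [/\ List.In u ts, u <> t & before m u].
  move=> /In_filter[uts /asboolPn ut]; split=> //.
  have [?|um] := mmax _ uts; first by left.
  right; split=> //; case: u uts ut um => // w uts ut wm.
  by apply: ut; rewrite tsplit // -wm.
have [||b [bP bts']] := IH ts'.
- apply: leq_trans tsn; apply: size_filter_lt tts _; apply/negPn; exact/asboolP.
- by move=> u /ts'P[/tsv].
(* [e x] is some branch through the node [x] of level [m], with [set0] as a dummy if there is none.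
   The formulas [s x] of the remaining tasks are the same for every branch through [x], so one
   choice per node serves all branches. *)
have rep x : exists y, (exists eta, node m eta = x) -> node m y = x.
  by have [[eta <-]|h] := pselect (exists eta, node m eta = x); [exists eta|exists set0].
have [e eP] := choice rep.
pose s x := map (fun t => ev b (form (e x) t)) ts'.
have sE b' eta u : List.In u ts' ->
  (forall u, below lt m u -> b u = b' u) ->
  (if u is TWit w th c then forall x, b (Wit w x th c) = b' (Wit w x th c) else True) ->
  ev b' (form eta u) = ev b (form (e (node m eta)) u).
  move=> /ts'P[uts ut um] h1 h2.
  rewrite -(@ev_local b b' m eta u (tsv _ uts) um h1 h2); congr ev.
  by apply: form_local um; apply/nodeP; rewrite eP //; exists eta.
have fin b' : in_P b' -> (forall u, below lt m u -> b u = b' u) ->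
   (forall u, List.In u ts' -> if u is TWit w th c then
      forall x, b (Wit w x th c) = b' (Wit w x th c) else True) ->
   (forall eta, realized_with r (ev b' (form eta t) :: s (node m eta))) ->
   exists b, in_P b /\ forall eta, realized_with r (map (fun t => ev b (form eta t)) ts).
  move=> b'P h1 h2 h3; exists b'; split=> // eta; apply: realized_withS (h3 eta).
  move=> _ /In_map[u uts <-]; have [->|ut] := pselect (u = t); first by left.
  have uts' : List.In u ts' by apply/In_filter; split=> //; apply/asboolPn.
  by right; rewrite (sE b' eta u) //; [apply/In_map; exists u|exact: h2].
have sr x : realized_with r (s x) by exact: bts'.
case Et: t => [w|w th c]; rewrite Et in lt_t tts fin; move: lt_t => /= wm.
(* Both signs are consistent at each node, so the parameters [a x] work for either value of [eta] at
   [m]. *)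
- have [a aP] := choice (fun x => splits (sr x)).
  pose b' u := match u with Par v x j => if `[< v = m >] then a x j else b u | _ => b u end.
  apply: (fin b').
  + by move=> *; apply: bP.
  + move=> [v x j|//|//] /= vm; case: asboolP => // E.
    by rewrite E in vm; case: (wo_irr ltwo vm).
  + by case.
  + move=> eta; set x := node m eta; have [h1 h2] := aP x.
    have E : ev b' (rename (omap (Par L w x)) psi) = rename (omap (a x)) psi.
      rewrite ev_split; apply: rename_agree => -[j|] //= _.
      by rewrite wm; case: asboolP.
    have -> : ev b' (form eta (TSplit w)) = if `[< eta w >] then rename (omap (a x)) psi
        else Not (rename (omap (a x)) psi).
      by rewrite -E /= wm; case: ifP.
    by case: ifP.
- have cl x : exists z : A, Pset P C (val z) /\ realized_with r
      (closing P (rename (omap (omap (eval a0 skolem b \o c))) th) z :: s x).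
    by have [z Pz h] := closes (rename (omap (omap (eval a0 skolem b \o c))) th) (sr x); exists z.
  have [B BP] := choice cl.
  (* Only the witness terms of the task [t] itself change; terms below [m], in particular the
     parameters [c] of [t], keep their values. *)
  pose b' u := match u with
    | Wit v x th' c' => if `[< TWit v th' c' = t >] then B x else b u | _ => b u end.
  have vt : valid t by apply: tsv; rewrite Et.
  have bb' u : below lt m u -> b u = b' u.
    case: u => [//|v x th' c'|//] /= vm; case: asboolP => // E.
    by move: vm; rewrite -wm; move: E; rewrite Et => -[-> _ _] /(wo_irr ltwo).
  apply: (fin b') => //.
  + by move=> v x th' c' /=; case: asboolP => _; [have [] := BP x|exact: bP].
  + move=> [//|v th' c'] /ts'P[_ ut _] x /=; by case: asboolP.
  + move=> eta; have [_] := BP (node m eta); rewrite [form _ _]/= ev_wit wm.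
    have -> : b' (Wit m (node m eta) th c) = B (node m eta).
      by rewrite /b' Et wm; case: asboolP.
    suff -> : rename (omap (omap (eval a0 skolem b' \o c))) th =
              rename (omap (omap (eval a0 skolem b \o c))) th by [].
    apply: rename_agree => -[[i|]|] //= _; congr (Some (Some _)).
    have vi : below lt m (c i) by rewrite -wm; rewrite Et in vt; exact: vt.
    by rewrite (eval_below _ _ bb' vi).
Qed.

End Branches.
End Tasks.

(** * Ultrafilter limits of valuations *)

Section Limit.
Variables (L : language) (C : structure L) (A : set C) (W X : Type).
Local Notation term := (term L W X).
Variables (a0 : A) (t0 : term).

Definition skolem (f : formula L (option nat)) (v : nat -> A) : A :=
  if pselect (exists a : A, sat (M := substructure A) f (oapp v a)) is left h
  then projT1 (cid h) else a0.

Lemma skolemP f v : (exists a : A, sat (M := substructure A) f (oapp v a)) ->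
  sat (M := substructure A) f (oapp v (skolem f v)).
Proof. by rewrite /skolem; case: pselect => // h _; case: cid. Qed.

Local Notation evalA := (eval a0 skolem).

(* [t] is the Skolem term of the negation of [f]. *)
Lemma skolem_term Y (f : formula L (option Y)) (rho : Y -> term) : exists t, forall b,
  sat (M := substructure A) f (oapp (evalA b \o rho) (evalA b t)) ->
  forall a, sat (M := substructure A) f (oapp (evalA b \o rho) a).
Proof.
pose s := pmap id (fv f).
pose f0 := Not (rename (omap (idx s)) f).
pose c i := nth t0 (map rho s) i.
exists (@Sk L W X f0 (size s) c) => b /=.
set v := (fun i => _).
have E a : sat (M := substructure A) f0 (oapp v a) <->
    ~ sat (M := substructure A) f (oapp (evalA b \o rho) a).
  rewrite /f0 sat_Not sat_rename.
  suff -> : sat (M := substructure A) f (oapp v a \o omap (idx s)) <->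
    sat (M := substructure A) f (oapp (evalA b \o rho) a) by [].
  apply: sat_agree => -[y|] //= yf; have ys : List.In y s by apply: In_pmap_id.
  by rewrite /v idx_lt // /c (nth_map y) ?idx_lt // nth_idx.
move=> h a; apply: contrapT => na.
by have /skolemP/E : exists a : A, sat (M := substructure A) f0 (oapp v a) by exists a; apply/E.
Qed.

Variables (U : set_system (term -> A)) (g : term -> C).
Hypothesis Uult : UltraFilter U.
Hypothesis gU : forall F : formula L term,
  sat F g <-> U [set b | sat F (fun t => val (evalA b t))].

Let A' := range g.
Let g' (t : term) : A' := toset (ex_intro2 _ _ t I erefl : A' (g t)).

(** Łoś's theorem for substructures. Atomic formulas mean the same in a substructure as in [C],
    where [gU] applies. For a universal formula, the Skolem term of the negation evaluates to a
    counterexample whenever there is one, and [g] is defined at that term. *)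
Lemma range_sat Y (f : formula L Y) (rho : Y -> term) :
  sat (M := substructure A') f (g' \o rho) <->
  U [set b | sat (M := substructure A) f (evalA b \o rho)].
Proof.
elim: f rho => [Y' n R t|Y' x y||Y' f IHf h IHh|Y' f IH] rho /=.
- transitivity (sat (Rel R (map_tuple rho t)) g).
    by rewrite /= !map_tuple_comp.
  by rewrite gU; split; apply: filterS => b /=; rewrite !map_tuple_comp.
- transitivity (sat (Eq L (rho x) (rho y)) g).
    by split=> [/(congr1 val)//|h]; apply: val_inj.
  rewrite gU; split; apply: filterS => b /=; first exact: val_inj.
  by move=> ->.
- by split=> // U0; have [] := filter_ex U0.
- rewrite IHf IHh; split=> [h'|h' hf]; last first.
    by apply: filterS (filterI h' hf) => b [h1 /h1].
  have [Uf|Uf] := in_ultra_setVsetC [set b | sat (M := substructure A) f (evalA b \o rho)] Uult.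
    by apply: filterS (h' Uf) => b hb _.
  by apply: filterS Uf => b nf /nf.
- have E (k : term -> A') v : k \o oapp rho v = oapp (k \o rho) (k v) by apply/funext; case.
  have E2 (k : term -> A) v : k \o oapp rho v = oapp (k \o rho) (k v) by apply/funext; case.
  split=> [h|h a'].
    have [t tP] := skolem_term f rho.
    have := h (g' t); rewrite -E => /IH; apply: filterS => b /=; rewrite E2; exact: tP.
  have [t _ gt] := set_valP a'.
  have -> : a' = g' t by apply: val_inj.
  by rewrite -E; apply/IH; apply: filterS h => b /=; rewrite E2.
Qed.

Lemma range_elem_equiv : elem_equiv A' A.
Proof.
have E (M : structure L) s (v w : void -> M) : sat s v -> sat s w.
  by apply: (iffLR _); apply: sat_agree => -[].
apply/seteqP; split=> s sA.
- have /range_sat/filter_ex[b] : sat (M := substructure A') s (g' \o @of_void term).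
    exact: E sA.
  exact: E.
- apply: (E (substructure A') _ (g' \o @of_void term)); apply/range_sat.
  by apply: filterS filterT => b _; apply: E sA.
Qed.

End Limit.

Lemma finite_params L V (v0 : V) (F : formula L (option (option V))) :
  exists (th : formula L (option (option nat))) (s : seq V),
    F = rename (omap (omap (nth v0 s))) th.
Proof.
pose s := pmap id (pmap id (fv F)).
exists (rename (omap (omap (idx s))) F), s.
rewrite rename_comp -[LHS]rename_id; apply: rename_agree => -[[v|]|] //= vF.
by rewrite nth_idx //; do 2!apply: In_pmap_id.
Qed.

(** * Counting types over a set elementarily equivalent to A *)

Section Counting.
Variables (L : language) (P : rel_symbol L 1) (C : structure L).
Variables (kappa : cardinal) (A : set C).
Local Notation K := (formula L nat).
Hypotheses (Csat : saturated1 kappa C) (kappa_sl : strong_limit kappa).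
Hypotheses (Kk : inj_lt K kappa) (Ak : inj_lt A kappa).
Hypothesis Astable : forall A' : set C, inj_lt A' kappa -> elem_equiv A' A ->
  inj_le (S_star P A') (K -> A').
Variables (lam : cardinal) (r : set (formula L (option A))).
Hypotheses (Kl : inj_lt K lam) (rl : inj_lt r lam) (PA : P_compact lam P A).
Variable (a0 : A).
Hypotheses (Pa0 : Pset P C (val a0)) (r0 : realized_with r [::]).

Section Branches.
Variables (psi : formula L (option nat)) (W : Type) (lt : W -> W -> Prop).
Variable node : W -> set W -> set K.
Hypotheses (ltwo : is_wo lt) (WK : inj_le W (set K)).
Hypotheses (nomax : forall w, exists w', lt w w').
Hypothesis nodeP : forall w B B',
  node w B = node w B' <-> (forall v, lt v w -> B v <-> B' v).
Hypothesis splits : forall s, realized_with r s -> exists a : nat -> A,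
  realized_with r (rename (omap a) psi :: s) /\
  realized_with r (Not (rename (omap a) psi) :: s).
Variable w0 : W.

Local Notation term := (term L W (set K)).
Local Notation evalA := (eval a0 (@skolem L C A a0)).
Local Notation ev := (ev a0 (@skolem L C A a0)).
Local Notation form := (@form L P W (set K) node psi).
Local Notation valid := (@valid L W (set K) lt).
Let t0 : term := Par L w0 set0 0.

Let nK : inj_le nat K. Proof. exact: inj_le_formula_nat. Qed.
Let nk : inj_lt nat kappa. Proof. exact: inj_le_lt_trans nK Kk. Qed.
Let nl : inj_lt nat lam. Proof. exact: inj_le_lt_trans nK Kl. Qed.

Lemma term_le : inj_le term (set K).
Proof.
apply: inj_le_term => //; last exact: inj_lexx.
by exists (fun k => [set k]) => a b /seteqP[/(_ a erefl)].
Qed.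

Lemma term_lt : inj_lt term kappa.
Proof. exact: inj_le_lt_trans term_le (strong_limitP kappa_sl Kk). Qed.

(** The valuations that serve a given finite list of valid tasks generate a proper filter; [g]
    realizes in [C] the limit of their values along an ultrafilter extending it. *)
Lemma generic_valuation : exists (U : set_system (term -> A)) (g : term -> C),
  [/\ UltraFilter U,
      forall F : formula L term, sat F g <-> U [set b | sat F (fun t => val (evalA b t))],
      U (@in_P L P W (set K) C A) &
      forall eta ts, (forall t, List.In t ts -> valid t) ->
        U [set b | realized_with r (map (fun t => ev b (form eta t)) ts)]].
Proof.
pose G (ts : seq (task L W (set K))) := [set b : term -> A | in_P P b /\
  forall eta, realized_with r (map (fun t => ev b (form eta t)) ts)].
pose D := [set ts : seq (task L W (set K)) | forall t, List.In t ts -> valid t].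
have FF : ProperFilter (filter_from D G).
  apply: filter_from_proper; last first.
    move=> ts tsv; apply: (branches_realized ltwo nodeP) tsv => // s th sr.
    apply: (realized_with_closing (kappa := kappa) (lam := lam)) => //.
    by exists a0.
  apply: filter_from_filter; first by exists [::].
  move=> s t sD tD; exists (s ++ t); first by move=> f /In_cat[/sD|/tD].
  move=> b [bP bst]; split; split=> // eta; apply: realized_withS (bst eta) => f.
    by move=> /In_map[u us <-]; apply/In_map; exists u => //; apply/In_cat; left.
  by move=> /In_map[u us <-]; apply/In_map; exists u => //; apply/In_cat; right.
have [U [Uult FU]] := ultraFilterLemma FF.
have [tlt tltwo] := well_orderable term.
have segk v : inj_lt (seg tlt v + void) kappa.
  apply: inj_lt_sum => //; first exact: inj_le_lt_trans (inj_le_set _) term_lt.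
  by apply: inj_le_lt_trans nk; exists (fun=> 0); case.
have [g gU] := realize_ultra (@of_void C) (fun b t => val (evalA b t))
    Csat tltwo (val a0) segk Uult.
have GU ts : D ts -> U (G ts) by move=> Dts; apply: FU; exists ts.
exists U, g; split=> //.
- move=> F; have sumE (h : term -> C) : sat (rename inl F) (sumv h (@of_void C)) <-> sat F h.
    by rewrite sat_rename; apply: sat_agree.
  split=> [/sumE/gU|UF]; first by apply: filterS => b /sumE.
  by apply/sumE/gU; apply: filterS UF => b Fb; apply/sumE.
- by have := GU [::] (fun t (h : False) => match h with end); apply: filterS => b [].
- by move=> eta ts tsv; apply: filterS (GU ts tsv) => b [_]; exact.
Qed.

(** Saturation realizes all valid tasks of a branch at once over the range of [g]. The witness tasks
    put the type of the realization in [S_*], and the splitting tasks separate the branches. *)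
Lemma many_types : exists A' : set C,
  [/\ inj_lt A' kappa, elem_equiv A' A, inj_le A' (set K) & inj_le (set W) (S_star P A')].
Proof.
have [U [g [Uult gU UP Ur]]] := generic_valuation.
pose A' := range g; pose g' (t : term) : A' := toset (ex_intro2 _ _ t I erefl : A' (g t)).
have A't : inj_le A' term by exact: inj_le_range.
have A'k : inj_lt A' kappa by exact: inj_le_lt_trans A't term_lt.
exists A'; split => //.
- by have := range_elem_equiv t0 Uult gU.
- exact: inj_le_trans A't term_le.
have real eta : exists c, forall t, valid t -> sat (form eta t) (oapp g c).
  have [|s sS|c cS] := @Csat term g _ [set form eta t | t in valid]; first exact: term_lt.
    have [|ts [ts1 ts2]] := @In_choice _ _ (fun t f => valid t /\ form eta t = f) s.
      by move=> f /sS[t vt <-]; exists t.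
    have tsv t : List.In t ts -> valid t by move=> /ts1[f _ []].
    have : sat (Ex (conj s)) g.
      apply/gU; apply: filterS (Ur eta ts tsv) => b [c [_ cb]].
      apply/sat_Ex; exists c; apply/sat_conj => f /ts2[t tts [_ <-]].
      have := cb (ev b (form eta t)); rewrite /ev sat_rename => h.
      apply: (iffLR _) (h _); last by apply/In_map; exists t.
      by apply: sat_agree => -[].
    by move=> /sat_Ex[c /sat_conj cs]; exists c.
  by exists c => t vt; apply: cS; exists t.
have [c cP] := choice real.
have gWitP w x th ch : Pset P C (g (Wit w x th ch)).
  apply/(sat_inP P (Wit w x th ch) g)/gU; apply: filterS UP => b bP.
  by apply/sat_inP; exact: bP.
(* The parameters of [F] are finitely many terms, all below some level [w], so a witness task of
   that level deals with [F]. *)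
have closed eta (F : formula L (option (option term))) :
    (exists2 z, Pset P C z & sat F (oapp (oapp g (c eta)) z)) ->
    exists t, Pset P C (g t) /\ sat F (oapp (oapp g (c eta)) (g t)).
  move=> Fz; have [th [s FE]] := finite_params t0 F.
  have [w ws] := below_bound_seq w0 (t0 :: s) ltwo nomax.
  pose t := TWit w th (nth t0 s).
  have vt : valid t.
    move=> i /=; apply: ws; case: (ltnP i (size s)) => [|h]; last by rewrite nth_default //; left.
    elim: (s) i => // u v IH [|i] /=; first by right; left.
    by move=> /IH[<-|]; [left|right; right].
  have /= := cP eta t vt; rewrite -FE => /sat_closing/(_ Fz) h.
  by exists (Wit w (node w eta) th (nth t0 s)).
pose p eta := existT (fun n => set (formula_over A' n)) 1 (tp A' [tuple c eta]).
have pS eta : S_star P A' (p eta).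
  exists 1, [tuple c eta]; split=> //; first exact: adjoin_P (closed eta).
  exact: adjoin_complete (closed eta).
exists (fun eta => toset (pS eta)) => eta eta' /(congr1 val) /= pp.
have {pp} tpE : tp A' [tuple c eta] = tp A' [tuple c eta'].
  exact: Eqdep_dec.inj_pair2_eq_dec (fun m n => decP eqP) _ _ _ _ pp.
apply/funext => w; apply: contrapT => nw.
(* At the first difference [w1] both branches pass through the same node, so they contain the same
   instance of [psi] with opposite signs. *)
have [{nw} w1 w1P w1min] := wf_min (wo_wf ltwo)
  (ex_intro _ w nw : [set w | eta w <> eta' w] !=set0).
have nE : node w1 eta = node w1 eta'.
  apply/nodeP => v vw; have : ~ (eta v <> eta' v) by move=> /w1min/(_ vw).
  by move=> /contrapT ->.
pose f : formula_over A' 1 := rename (fun o => if o is Some j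
  then inr (g' (Par L w1 (node w1 eta) j)) else inl ord0) psi.
have fE z : tp A' [tuple c z] f <->
    sat (rename (omap (Par L w1 (node w1 eta))) psi) (oapp g (c z)).
  rewrite /tp /= holdsE /f !sat_rename; apply: sat_agree => -[j|] //= _.
have ff : tp A' [tuple c eta] f <-> tp A' [tuple c eta'] f by rewrite tpE.
apply: w1P; apply/propext; move: ff; rewrite !fE.
have := cP eta (TSplit _ _ w1) I; have := cP eta' (TSplit _ _ w1) I.
rewrite /= -nE; case: asboolP => h1; case: asboolP => h2 //= h3 h4 [h5 h6].
- by case: h4; apply: h6.
- by case: h3; apply: h5.
Qed.

End Branches.

Theorem exists_deciding (psi : formula L (option nat)) : exists2 s,
  realized_with r s &
  forall a : nat -> A, realized_with r (rename (omap a) psi :: s) ->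
    ~ realized_with r (Not (rename (omap a) psi) :: s).
Proof.
apply: contrapT => nex.
have splits s : realized_with r s -> exists a : nat -> A,
    realized_with r (rename (omap a) psi :: s) /\
    realized_with r (Not (rename (omap a) psi) :: s).
  move=> sr; apply: contrapT => na; apply: nex; exists s => // a h1 h2.
  by apply: na; exists a.
have nsK : inj_le nat (set K).
  apply: inj_le_trans (inj_le_formula_nat L) _.
  by exists (fun k => [set k]) => a b /seteqP[/(_ a erefl)].
have [W [lt [node [ltwo nW WK nomax nodeP]]]] := power_tree nsK.
have [w0] : exists w0 : W, True.
  apply: contrapT => nw; apply: nW; exists (fun=> set0) => B B' _.
  by apply/funext => w; case: nw; exists w.
move=> _; have [A' [A'k A'A A'K WA']] := many_types ltwo WK nomax nodeP splits w0.
(* 2^W <= |S_*(A')| <= |A'|^|T| <= (2^|T|)^|T| = 2^|T|. *)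
apply: nW; apply: inj_le_trans WA' (inj_le_trans (Astable A'k A'A) _).
apply: inj_le_trans (inj_le_pow K A'K) _.
apply: (@inj_le_trans (set (K * K))).
  exists (fun F => [set p | F p.1 p.2]) => F G FG; apply/funext => x; apply/funext => y.
  by have /(congr1 (fun S => S (x, y))) := FG.
apply: inj_le_set_mono; apply: inj_le_square; exact: inj_le_formula_nat.
Qed.

End Counting.

(** * Isolated types over a complete set *)

Section Isolating.
Variables (L : language) (P : rel_symbol L 1) (C : structure L).
Variables (kappa : cardinal) (A : set C).
Local Notation K := (formula L nat).
Hypotheses (Csat : saturated1 kappa C) (kappa_sl : strong_limit kappa).
Hypotheses (Kk : inj_lt K kappa) (Ak : inj_lt A kappa).
Hypothesis Astable : forall A' : set C, inj_lt A' kappa -> elem_equiv A' A ->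
  inj_le (S_star P A') (K -> A').
Variables (lam : cardinal) (r : set (formula L (option A))).
Hypotheses (Kl : inj_lt K lam) (rl : inj_lt r lam) (PA : P_compact lam P A).
Variable (a0 : A).
Hypotheses (Pa0 : Pset P C (val a0)) (r0 : realized_with r [::]).

Let nl : inj_lt nat lam := inj_le_lt_trans (inj_le_formula_nat L) Kl.

Let F := formula L (option nat).

Let FK : inj_le F K.
Proof.
exists (rename pickle); apply: (rename_inj None).
exact: pcan_inj (@pickleK (option nat)).
Qed.

(** The formulas [psi] are taken without parameters, so there are only |T| of them; each contributes
    a finite list that decides all its instances over [r] and the earlier lists. A finite part of
    the union uses lists up to a greatest index and is consistent by the choice made there. *)
Lemma exists_isolating : exists R : set (formula L (option A)),
  [/\ r `<=` R, inj_lt R lam, realized_with R [::] &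
      forall x y : C, (forall f, R f -> sat f (oapp val x)) ->
        (forall f, R f -> sat f (oapp val y)) ->
        forall f : formula L (option A), sat f (oapp val x) -> sat f (oapp val y)].
Proof.
have [lt ltwo] := well_orderable F.
pose ext (J : set F) (s : F -> seq (formula L (option A))) :=
  r `|` [set f | exists2 j, J j & List.In f (s j)].
pose deciding (R : set (formula L (option A))) (psi : F) s := realized_with R s /\
  forall a : nat -> A, realized_with R (rename (omap a) psi :: s) ->
    ~ realized_with R (Not (rename (omap a) psi) :: s).
have [s sP] := wf_choose (fun (k : F) rel z => deciding
  (r `|` [set f | exists j t, rel j t /\ List.In f t]) k z) [::] (wo_wf ltwo).
have extE k : r `|` [set f | exists j t, (lt j k /\ s j = t) /\ List.In f t] = ext (seg lt k) s.
  rewrite /ext; congr (_ `|` _); apply/seteqP; split=> f.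
    by move=> [j [t [[jk <-] ft]]]; exists j.
  by move=> [j jk fs]; exists j, (s j).
have ext_lt J : inj_lt (ext J s) lam.
  apply: inj_le_lt_trans (inj_le_setU _ _) _; apply: inj_lt_sum => //.
  apply: (@inj_le_lt_trans (F * nat)).
    apply: (inj_le_surj (f := fun p => nth Bot (s p.1) p.2)) => f [j _ fs].
    by exists (j, idx (s j) f); rewrite /= nth_idx.
  by apply: inj_lt_prod => //; apply: inj_le_lt_trans FK Kl.
have ext_realized (J : set F) : (forall i j, lt i j -> J j -> J i) ->
    (forall j, J j -> deciding (ext (seg lt j) s) j (s j)) -> realized_with (ext J s) [::].
  move=> Jdown Jd.
  have [|t tJ|x xJ] := @Csat A val _ (ext J s); [exact: Ak| |by exists x].
  pose R j f := List.In f (s j) /\ J j.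
  pose t' := seq.filter (fun f => ~~ `[< r f >]) t.
  have [|js [js1 js2]] := @In_choice _ _ R t'.
    by move=> f /In_filter[/tJ[rf /asboolPn//|[j Jj fj] _]]; exists j.
  have tr f : List.In f t -> r f \/ exists2 j, List.In j js & R j f.
    move=> ft; have [rf|nr] := pselect (r f); first by left.
    by right; apply: js2; apply/In_filter; split=> //; apply/asboolPn.
  case: js js1 tr {js2} => [_ tr|j0 js js1 tr].
    by have [x [xr _]] := r0; exists x => f /tr[/xr//|[]].
  have [m [mjs mmax]] := In_max ltwo j0 js.
  have Jm : J m by have [f _ []] := js1 _ mjs.
  have [[x [xr xs]] _] := Jd _ Jm.
  exists x => f /tr[rf|[j jjs [fj Jj]]]; first by apply: xr; left.
  have [jm|E] := mmax _ jjs; first by apply: xr; right; exists j.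
  by apply: xs; rewrite -E.
have all_dec k : deciding (ext (seg lt k) s) k (s k).
  elim/(well_founded_ind (wo_wf ltwo)): k => k IH.
  have := sP k; rewrite /= extE; apply.
  have [|t t1 t2] := exists_deciding Csat kappa_sl Kk Ak Astable Kl (ext_lt (seg lt k)) PA Pa0 _ k.
    by apply: ext_realized => // i j ij jk; exact: wo_trans ij jk.
  by exists t.
exists (ext setT s); split=> //; first by move=> f rf; left.
  by apply: ext_realized => // j _; exact: all_dec.
move=> x y xR yR f fx; apply: contrapT => nfy.
(* [f] is an instance of the parameter-free formula [k]; the points [x] and [y] would show both
   signs of it consistent with the list [s k]. *)
pose l := pmap id (fv f); pose k : F := rename (omap (idx l)) f.
have kE : rename (omap (nth a0 l)) k = f.
  rewrite rename_comp -[RHS]rename_id; apply: rename_agree => -[v|] //= vF.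
  by rewrite nth_idx //; apply: In_pmap_id.
have sub z : (forall f, ext setT s f -> sat f (oapp val z)) ->
    forall g, sat g (oapp val z) -> realized_with (ext (seg lt k) s) (g :: s k).
  move=> zR g gz; exists z; split=> [h [rh|[j _ hj]]|h [<-//|hk]]; apply: zR.
  - by left.
  - by right; exists j.
  - by right; exists k.
have [_ /(_ (nth a0 l))] := all_dec k; rewrite kE => h.
exact: h (sub x xR f fx) (sub y yR (Not f) nfy).
Qed.

(** A witness in [A] is found at some realization [x] of [R], and passes to [c] because [R] isolates
    the type of [c]. *)
Lemma isolating_complete (R : set (formula L (option A))) (c : C) : inj_lt R lam ->
  (forall f, R f -> sat f (oapp val c)) ->
  (forall x, (forall f, R f -> sat f (oapp val x)) ->
     forall f : formula L (option A), sat f (oapp val x) -> sat f (oapp val c)) ->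
  complete_set P (A `|` range (tnth [tuple c])) /\
  Pset P C `&` (A `|` range (tnth [tuple c])) = Pset P C `&` A.
Proof.
move=> Rl cR Rc.
have closed (G : formula L (option (option A))) :
  (exists2 z, Pset P C z & sat G (oapp (oapp val c) z)) ->
  exists q : A, Pset P C (val q) /\ sat G (oapp (oapp val c) (val q)).
  move=> Gc; have [||b Pb [x [xR xb]]] :=
      realized_with_closing (s := [::]) G Csat Ak nl Rl PA.
  - by exists a0.
  - by exists c.
  exists b; split=> //; have /Rc := xR; move=> /(_ _ (xb _ (or_introl erefl))).
  by move=> /sat_closing; apply.
have <- : range (fun a : A => val a) = A.
  by apply/seteqP; split=> [_ [a _ <-]|a Aa]; [exact: set_valP|exists (toset Aa)].
by split; [exact: adjoin_complete closed|exact: adjoin_P closed].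
Qed.

End Isolating.

(** * The construction of the model *)

Section Types1.
Variables (L : language) (C : structure L) (D : set C).

Definition to_over (f : formula L (option D)) : formula_over D 1 :=
  rename (fun o => if o is Some d then inr d else inl ord0) f.

Definition of_over (f : formula_over D 1) : formula L (option D) :=
  rename (fun u => match u with inl _ => None | inr d => Some d end) f.

Lemma holds_to_over f (x : 1.-tuple C) :
  holds (to_over f) x <-> sat f (oapp val (tnth x ord0)).
Proof. by rewrite holdsE sat_rename; apply: sat_agree => -[]. Qed.

Lemma sat_of_over (f : formula_over D 1) (x : 1.-tuple C) :
  sat (of_over f) (oapp val (tnth x ord0)) <-> holds f x.
Proof. by rewrite holdsE sat_rename; apply: sat_agree => -[i|] //= _; rewrite ord1. Qed.

Lemma tp_sat c f : tp D [tuple c] (to_over f) <-> sat f (oapp val c).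
Proof. exact: holds_to_over. Qed.

Lemma tp_eqP c c' : tp D [tuple c] = tp D [tuple c'] <->
  forall f : formula L (option D), sat f (oapp val c) -> sat f (oapp val c').
Proof.
split=> [E f /tp_sat|h]; first by rewrite E => /tp_sat.
apply/seteqP; split=> f /= /sat_of_over fc; apply/sat_of_over; first exact: h.
by apply: contrapT => n; have := h (Not (of_over f)) n; apply.
Qed.

Lemma isolatedP (lam : cardinal) c : isolated lam (tp D [tuple c]) <->
  exists R : set (formula L (option D)),
    [/\ inj_lt R lam, forall f, R f -> sat f (oapp val c) &
        forall x, (forall f, R f -> sat f (oapp val x)) ->
          tp D [tuple x] = tp D [tuple c]].
Proof.
split=> [[r [rp rl rE]]|[R [Rl cR RE]]].
  exists (of_over @` r); split.
  - by move/card_ltTl: rl; apply: inj_le_lt_trans; apply/inj_leP/card_image_le.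
  - by move=> _ [f /rp fc <-]; apply/(sat_of_over f [tuple c]).
  move=> x xr; have /rE xp : realizes [tuple x] r.
    by move=> f rf; apply/sat_of_over; apply: xr; exists f.
  apply/esym/tp_eqP => f /tp_sat/xp; exact: (tp_sat x f).1.
exists (to_over @` R); split.
- by move=> _ [f /cR fc <-]; apply/tp_sat.
- by apply/card_ltTl; apply: inj_le_lt_trans Rl; apply/inj_leP/card_image_le.
- move=> x; have xE : x = [tuple tnth x ord0] by apply: eq_from_tnth => i; rewrite ord1.
  split=> [xr|xp].
    have {}/RE E : forall f, R f -> sat f (oapp val (tnth x ord0)).
      by move=> f Rf; apply/holds_to_over; apply: xr; exists f.
    by move=> f; rewrite -E xE.
  by move=> _ [f /cR/tp_sat/xp fx <-].
Qed.

Lemma enumerate_types (P : rel_symbol L 1) (X : Type) (c0 : C) :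
  inj_le (S_star P D) X -> exists e : X -> C, forall c,
    complete_set P (D `|` range (tnth [tuple c])) ->
    Pset P C `&` (D `|` range (tnth [tuple c])) = Pset P C `&` D ->
    exists x, tp D [tuple e x] = tp D [tuple c].
Proof.
move=> [h hI].
pose p c := existT (fun n => set (formula_over D n)) 1 (tp D [tuple c]).
pose G c x := exists q : S_star P D, val q = p c /\ h q = x.
have rep x : exists c, (exists c', G c' x) -> G c x.
  by have [[c Gc]|n] := pselect (exists c, G c x); [exists c|exists c0].
have [e eP] := choice rep; exists e => c cc cP.
have Sc : S_star P D (p c) by exists 1, [tuple c].
exists (h (toset Sc)).
have [|q [qE /hI qS]] := eP (h (toset Sc)); first by exists c, (toset Sc).
have /= : p c = p (e (h (toset Sc))) by rewrite -qE qS.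
by move=> /esym E; apply: Eqdep_dec.inj_pair2_eq_dec (fun m n => decP eqP) _ _ _ _ E.
Qed.

End Types1.

(** A formula has finitely many parameters; these lie in a complete subset of [D], where the
    solution in [P] is found. *)
Lemma complete_union L (P : rel_symbol L 1) (C : structure L) (D : set C) :
  (forall s, (forall x, List.In x s -> D x) -> exists E,
     [/\ E `<=` D, complete_set P E & forall x, List.In x s -> E x]) ->
  complete_set P D.
Proof.
move=> h; apply: complete_of_1 => f z Pz fz.
pose s := map (fun d : D => val d) (pmap id (fv f)).
have [|E [ED Ec sE]] := h s; first by move=> x /In_map[d _ <-]; apply: set_valP.
(* Parameters outside [E] do not occur in [f]; sending them to the variable is a dummy value. *)
pose u (d : D) : option E := if pselect (E (val d)) is left p then Some (toset p) else None.
have uE y : sat (rename (fun o => obind u o) f) (oapp val y) <-> sat f (oapp val y).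
  rewrite sat_rename; apply: sat_agree => -[d|] //= df; rewrite /u.
  case: pselect => //; case; apply: sE; apply/In_map; exists d => //.
  exact: In_pmap_id.
have [|y [Ey Py] fy] := complete_1 (f := rename (fun o => obind u o) f) Ec Pz.
  exact/uE.
by exists y; [split=> //; exact: ED|exact/uE].
Qed.

Lemma Tarski_Vaught L (C : structure L) (B : set C) (b0 : B) :
  (forall (f : formula L (option nat)) (v : nat -> B) x,
     sat f (oapp (fun i => val (v i)) x) ->
     exists b : B, sat f (oapp (fun i => val (v i)) (val b))) ->
  forall X (f : formula L X) (rho : X -> B),
    sat (M := substructure B) f rho <-> sat f (fun x => val (rho x)).
Proof.
move=> wit X f; elim: f => [X' n R t|X' x y||X' f IHf g IHg|X' f IH] rho /=.
- by rewrite map_tuple_comp.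
- by split=> [->//|]; exact: val_inj.
- by [].
- by rewrite IHf IHg.
have E b : (fun o => val (oapp rho b o)) = oapp (fun x => val (rho x)) (val b).
  by apply/funext; case.
split=> h; last by move=> b; apply/IH; rewrite E.
move=> a; apply: contrapT => na.
pose s := pmap id (fv f).
pose f0 := Not (rename (omap (idx s)) f).
pose v i := nth b0 (map rho s) i.
have f0E z : sat f0 (oapp (fun i => val (v i)) z) <-> ~ sat f (oapp (fun x => val (rho x)) z).
  rewrite /f0 sat_Not sat_rename.
  suff -> : sat f (oapp (fun i => val (v i)) z \o omap (idx s)) <->
    sat f (oapp (fun x => val (rho x)) z) by [].
  apply: sat_agree => -[y|] //= yf; have ys : List.In y s by apply: In_pmap_id.
  by rewrite /v (nth_map y) ?idx_lt // nth_idx.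
have [|b /f0E] := wit f0 v a; first exact/f0E.
by apply; have /IH := h b; rewrite E.
Qed.

(** Otherwise the formulas [x <> a], for [a] in [N], would be fewer than [lam]. They are finitely
    satisfiable, as [N] inherits from [B] that it is infinite, but no point of [N] satisfies them
    all. *)
Lemma compact_infinite L (C : structure L) (lam : cardinal) (N B : set C) :
  infinite_set B -> elem_sub N B -> compact_struct lam (substructure N) -> inj_le lam N.
Proof.
move=> Binf [NB Nel] Nc; apply: contrapT => Nlam.
pose F (a : N) : formula_over [set: substructure N] 1 :=
  Not (Eq L (inl ord0) (inr (toset (I : [set: substructure N] a)))).
have [||x xr] := Nc 1 [set F a | a in setT].
- by apply/card_ltTl; apply: inj_le_lt_trans Nlam; exact: inj_le_range.
- move=> r0 r0F /finite_setE[s r0s].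
  have [|t [t1 t2]] := @In_choice _ _ (fun a f => F a = f) s.
    by move=> f /r0s/r0F[a _ <-]; exists a.
  pose G : formula L 'I_(size t) :=
    Ex (conj (map (fun i => Not (Eq L None (Some i))) (enum 'I_(size t)))).
  have GE (M : structure L) (e : 'I_(size t) -> M) : sat G e <-> exists y, forall i, y <> e i.
    rewrite /G sat_Ex; split=> -[y yP]; exists y.
      move=> i; have /sat_conj := yP.
      move=> /(_ (Not (Eq L None (Some i)))); apply; apply/In_map; exists i => //.
      elim: (enum _) (mem_enum 'I_(size t) i) => //= j u IH; rewrite inE.
      by move=> /orP[/eqP->|/IH]; [left|right].
    by apply/sat_conj => _ /In_map[i _ <-]; exact: yP.
  pose y := [tuple (toset (NB _ (set_valP (tnth (in_tuple t) i))) : B) | i < size t].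
  have xy i : val (tnth (in_tuple t : (size t).-tuple (substructure N)) i) =
      val (tnth (y : (size t).-tuple (substructure B)) i) by rewrite tnth_mktuple.
  have /GE[a aP] : sat G (tnth (in_tuple t : (size t).-tuple (substructure N))).
    apply/(Nel _ G _ _ xy)/GE; apply: contrapT => na; apply: Binf.
    apply: (@sub_finite_set _ _ [set val b | b in [set b : B | exists i, b = tnth y i]]).
      move=> b Bb; exists (toset Bb) => //=; apply: contrapT => nb; apply: na.
      by exists (toset Bb) => i E; apply: nb; exists i.
    apply: finite_image; rewrite (_ : mkset _ = range (tnth y)).
      by apply: finite_image; exact: finite_finset.
    by apply/seteqP; split=> b [i]; [move=> ->; exists i|move=> _ <-; exists i].
  exists [tuple a] => f /r0s/t2[b bt <-] /= E.
  move: E; rewrite /holds /=; rewrite (tnth_nth a) /= => E.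
  have [i ib] : exists i, tnth (in_tuple t) i = b.
    elim: (t) bt => //= b' u IH [->|/IH[i <-]]; first by exists ord0; rewrite (tnth_nth b).
    by exists (lift ord0 i); rewrite !(tnth_nth b).
  by apply: (aP i); rewrite ib.
have := xr _ (ex_intro2 _ _ (tnth x ord0) I erefl).
by move=> /=; apply.
Qed.

Definition lex X Y (ltX : X -> X -> Prop) (ltY : Y -> Y -> Prop) (p q : X * Y) : Prop :=
  ltX p.1 q.1 \/ p.1 = q.1 /\ ltY p.2 q.2.

Lemma is_wo_lex X Y (ltX : X -> X -> Prop) (ltY : Y -> Y -> Prop) :
  is_wo ltX -> is_wo ltY -> is_wo (lex ltX ltY).
Proof.
move=> Xwo Ywo; split.
- move=> [x y]; elim/(well_founded_ind (wo_wf Xwo)): x y => x IHx y.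
  elim/(well_founded_ind (wo_wf Ywo)): y => y IHy.
  by constructor => -[x' y'] [/= /IHx//|/= [-> /IHy]].
- move=> [x y] [x' y'] [x'' y''] [/= h|[/= -> h]] [/= h'|[/= <- h']].
  + by left; exact: wo_trans h h'.
  + by left.
  + by left.
  + by right; split=> //; exact: wo_trans h h'.
- move=> [x y] [x' y']; have [h|<-|h] := wo_total Xwo x x'.
  + by apply: Or31; left.
  + have [h|<-|h] := wo_total Ywo y y'; [apply: Or31|exact: Or32|apply: Or33];
      by right.
  + by apply: Or33; left.
Qed.

Lemma inj_le_pow_dom X Y Z (z0 : Z) : inj_le X Y -> inj_le (X -> Z) (Y -> Z).
Proof.
move=> XY; have [[x0]|nX] := pselect (exists x : X, True).
  move=> _; have [g gS] := inj_le_surjective XY x0.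
  exists (fun h => h \o g) => h k hk; apply/funext => x.
  by have [y <-] := gS x; have /(congr1 (fun u => u y)) := hk.
exists (fun h _ => z0) => h k _; apply/funext => x.
by case: nX; exists x.
Qed.

(** * The chain of isolated types *)

Section Construction.
Variables (L : language) (P : rel_symbol L 1) (T : set (sentence L)).
Variables (kappa : cardinal) (C : structure L).
Hypotheses (hC : monster kappa T C) (hP : standing_assumptions P T C).
Local Notation K := (formula L nat).
Variables (lam : cardinal) (N : set C).
Hypotheses (Kl : inj_lt K lam) (hN : submodel_P kappa P N).
Hypotheses (hNc : compact_struct lam (substructure N)) (hst : fully_stable kappa P N).

Let Csat : saturated1 kappa C := saturated_1 (monster_saturated hC).
Let kappa_sl : strong_limit kappa := monster_strong_limit hC.
Let Kk : inj_lt K kappa. Proof. exact/card_ltT/(monster_large hC). Qed.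
Let nK : inj_le nat K := inj_le_formula_nat L.
Let nk : inj_lt nat kappa := inj_le_lt_trans nK Kk.
Let nl : inj_lt nat lam := inj_le_lt_trans nK Kl.

Lemma lam_le_N : inj_le lam N.
Proof.
have [_ Nel] := hN; apply: compact_infinite Nel hNc.
exact (P_infinite hP (monster_models hC)).
Qed.

(** The invariant of the construction: stability over [N] and compactness of [N] apply to every such
    set, so isolated types are dense over it. *)
Definition nice (D : set C) : Prop :=
  [/\ inj_lt D kappa, complete_set P D & D `&` Pset P C = N].

Lemma nice_stable D : nice D -> forall D' : set C, inj_lt D' kappa -> elem_equiv D' D ->
  inj_le (S_star P D') (K -> D').
Proof.
move=> [Dk Dc DN] D' /card_ltTl D'k D'D; apply/inj_leTl.
have Ds : small kappa D by exact/card_ltTl.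
by have [_] := hst Ds Dc DN; apply.
Qed.

Lemma nice_P_compact D : nice D -> P_compact lam P D.
Proof.
move=> [Dk Dc DN]; apply: (P_compact_of_complete (monster_models hC) hP Dc).
by rewrite DN.
Qed.

Lemma nice_P_point D : nice D -> exists a : D, Pset P C (val a).
Proof.
move=> [_ _ DN]; have [l0 _] := inj_ltW nl; have [f _] := lam_le_N.
have := set_valP (f (l0 0)); rewrite -[X in X _]DN => -[Da Pa].
by exists (toset Da).
Qed.

Lemma extend_type (D : set C) (r : set (formula L (option D))) : nice D -> inj_lt r lam ->
  (exists x, forall f, r f -> sat f (oapp val x)) ->
  exists c, [/\ forall f, r f -> sat f (oapp val c), isolated lam (tp D [tuple c]),
    complete_set P (D `|` range (tnth [tuple c])) &
    Pset P C `&` (D `|` range (tnth [tuple c])) = Pset P C `&` D].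
Proof.
move=> Dn rl [x xr]; have [Dk Dc DN] := Dn.
have [a0 Pa0] := nice_P_point Dn; have PD := nice_P_compact Dn.
have [|R [rR Rl [c [cR _]] Riso]] := exists_isolating Csat kappa_sl Kk Dk
    (nice_stable Dn) Kl rl PD Pa0.
  by exists x.
have [cc cP] := isolating_complete Csat Dk Kl PD Pa0 Rl cR (fun x xR => Riso x c xR cR).
exists c; split=> //; first by move=> f /rR/cR.
apply/isolatedP; exists R; split=> // y yR.
by apply/tp_eqP; exact: Riso.
Qed.

Variables (A : set C) (R : cardinal).
Hypotheses (An : nice A) (hR : is_reg lam R).
Let X := K -> A.

Let a0 : A := projT1 (cid (nice_P_point An)).

Let NA : inj_le N A.
Proof. by have [_ _ <-] := An; apply: inj_le_sub => x []. Qed.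

Let AX : inj_le A X.
Proof. by exists (fun a _ => a) => a b /(congr1 (fun h => h Bot)). Qed.

Let lamX : inj_le lam X := inj_le_trans lam_le_N (inj_le_trans NA AX).

Let nX : inj_le nat X := inj_le_trans (inj_ltW nl) lamX.

Let powX (D : set C) : inj_le D X -> inj_le (K -> D) X.
Proof.
move=> DX; apply: inj_le_trans (inj_le_pow K DX) _.
apply: (@inj_le_trans (K * K -> A)).
  exists (fun F p => F p.1 p.2) => F G FG; apply/funext => x; apply/funext => y.
  by have /(congr1 (fun S => S (x, y))) := FG.
exact: inj_le_pow_dom a0 (inj_le_square nK).
Qed.

Let Xk : inj_lt X kappa.
Proof. by have [Ak _ _] := An; apply: inj_lt_pow. Qed.

(** [R] embeds in [set lam]: otherwise [set lam] would be smaller than [R] and so embed in [lam],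
    against Cantor's theorem. *)
Let Rk : inj_lt R kappa.
Proof.
have lk : inj_lt lam kappa by exact: inj_le_lt_trans lamX Xk.
apply: inj_le_lt_trans (strong_limitP kappa_sl lk); apply: contrapT => h.
exact: (@Cantor lam) (is_reg_lt (inj_ltW nl) hR h).
Qed.

(** The enumerations are fixed for all sets in advance, because the recursion refers to those over
    sets that it is still building. By stability [X] suffices to index the types, as |D|^|T| is at
    most |X|. *)
Lemma enumerations : exists e : set C -> X -> C, forall D, nice D -> inj_le D X ->
  forall c, complete_set P (D `|` range (tnth [tuple c])) ->
    Pset P C `&` (D `|` range (tnth [tuple c])) = Pset P C `&` D ->
    exists x, tp D [tuple e D x] = tp D [tuple c].
Proof.
have rep D : exists e : X -> C, nice D -> inj_le D X -> forall c,
    complete_set P (D `|` range (tnth [tuple c])) ->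
    Pset P C `&` (D `|` range (tnth [tuple c])) = Pset P C `&` D ->
    exists x, tp D [tuple e x] = tp D [tuple c].
  have [[Dn DX]|n] := pselect (nice D /\ inj_le D X); last first.
    by exists (fun=> val a0) => Dn DX; case: n.
  have [|e eP] := enumerate_types (D := D) (X := X) (P := P) (val a0); last by exists e.
  by apply: inj_le_trans (powX DX); apply: nice_stable => //; case: Dn.
by have [e eP] := choice rep; exists e.
Qed.

Section Chain.
Variables (ltR : R -> R -> Prop) (ltX : X -> X -> Prop) (e : set C -> X -> C).
Hypotheses (ltRwo : is_wo ltR) (segR : forall i, inj_lt (seg ltR i) R) (ltXwo : is_wo ltX).
Hypothesis eP : forall D, nice D -> inj_le D X ->
  forall c, complete_set P (D `|` range (tnth [tuple c])) ->
    Pset P C `&` (D `|` range (tnth [tuple c])) = Pset P C `&` D ->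
    exists x, tp D [tuple e D x] = tp D [tuple c].

Let Idx := (R * X)%type.
Let lt : Idx -> Idx -> Prop := lex ltR ltX.
Let ltwo : is_wo lt := is_wo_lex ltRwo ltXwo.

Definition base (d : Idx -> C) (i : R) : set C := A `|` d @` [set j | ltR j.1 i].
Definition stage (d : Idx -> C) (p : Idx) : set C := A `|` d @` seg lt p.

(* The chain is indexed by [R * X]: at [(i, x)] the [x]-th type over the set [B]
   constructed before level [i] is realized, provided it is isolated. *)
Let spec (D B : set C) (x : X) (z : C) : Prop :=
  [/\ isolated lam (tp D [tuple z]), complete_set P (D `|` range (tnth [tuple z])),
      Pset P C `&` (D `|` range (tnth [tuple z])) = Pset P C `&` D &
      isolated lam (tp B [tuple e B x]) -> tp B [tuple z] = tp B [tuple e B x]].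

Let good (d : Idx -> C) (p : Idx) : Prop := spec (stage d p) (base d p.1) p.2 (d p).

Let Ik : inj_lt Idx kappa. Proof. exact: inj_lt_prod. Qed.

(** Finitely many points of the chain lie in a stage together with its next point, which is
    complete. A point of [P] cannot be new at any stage, so by descent it lies in [A]. *)
Let nice_down (d : Idx -> C) (J : set Idx) : (forall p q, lt p q -> J q -> J p) ->
  (forall p, J p -> good d p) -> nice (A `|` d @` J).
Proof.
move=> Jdown Jgood; have [Ak Ac AN] := An; split.
- apply: inj_le_lt_trans (inj_le_setU _ _) _; apply: inj_lt_sum => //.
  apply: inj_le_lt_trans Ik; apply: inj_le_trans (inj_le_set J).
  by apply/inj_leP/card_image_le.
- apply: complete_union => s sD.
  pose s' := seq.filter (fun x => ~~ `[< A x >]) s.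
  have [|ps [ps1 ps2]] := @In_choice _ _ (fun p x => J p /\ d p = x) s'.
    by move=> x /In_filter[/sD[Ax /asboolPn//|[p Jp <-] _]]; exists p.
  have sA x : List.In x s -> A x \/ exists2 p, List.In p ps & J p /\ d p = x.
    move=> xs; have [Ax|nA] := pselect (A x); first by left.
    by right; apply: ps2; apply/In_filter; split=> //; apply/asboolPn.
  case: ps ps1 sA {ps2} => [_ sA|p0 ps ps1 sA].
    exists A; split=> //.
    by move=> x /sA[//|[p /= []]].
  have [m [mps mmax]] := In_max ltwo p0 ps.
  have Jm : J m by have [x _ []] := ps1 _ mps.
  have [_ mc _ _] := Jgood m Jm.
  exists (stage d m `|` range (tnth [tuple d m])); split=> //.
    move=> x [[Ax|[p pm <-]]|[i _ <-]]; first by left.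
      by right; exists p => //; apply: Jdown pm Jm.
    by right; exists m => //; rewrite (tnth_nth (d m)) ord1.
  move=> x /sA[Ax|[p pps [Jp <-]]]; first by left; left.
  have [pm|->] := mmax _ pps; first by left; right; exists p.
  by right; exists ord0.
- apply/seteqP; split=> [z [Dz Pz]|z]; last by rewrite -AN => -[Az Pz]; split=> //; left.
  rewrite -AN; split=> //; case: Dz => // -[p Jp dp].
  elim/(well_founded_ind (wo_wf ltwo)): p Jp dp => p IH Jp dp.
  have [_ _ pP _] := Jgood p Jp.
  have : (Pset P C `&` (stage d p `|` range (tnth [tuple d p]))) z.
    by split=> //; right; exists ord0.
  rewrite pP => -[_ [//|[q qp dq]]].
  by apply: (IH q) => //; apply: Jdown qp Jp.
Qed.

(** The fewer than [lam] formulas that isolate a type over the base are consistent over the larger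
    stage too. Density over the stage then gives a point with an isolated type there that still
    realizes the type over the base. *)
Lemma chain_exists : exists d : Idx -> C, forall p, good d p.
Proof.
have [d dP] := wf_choose (fun p r z => spec (A `|` [set y | exists q, r q y])
  (A `|` [set y | exists2 q, ltR q.1 p.1 & r q y]) p.2 z) (val a0) (wo_wf ltwo).
exists d; elim/(well_founded_ind (wo_wf ltwo)) => p IH.
have := dP p; rewrite /=.
have -> : [set y | exists q, lt q p /\ d q = y] = d @` seg lt p.
  by apply/seteqP; split=> y; [move=> [q [qp <-]]; exists q|move=> [q qp <-]; exists q].
have -> : [set y | exists2 q, ltR q.1 p.1 & lt q p /\ d q = y] = d @` [set q | ltR q.1 p.1].
  apply/seteqP; split=> y; first by move=> [q qp [_ <-]]; exists q.
  by move=> [q qp <-]; exists q => //; split=> //; left.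
apply; rewrite -/(stage d p) -/(base d p.1).
have Dn : nice (stage d p).
  by apply: nice_down => // q q' qq' q'p; exact: wo_trans qq' q'p.
have BD : base d p.1 `<=` stage d p.
  by move=> y [Ay|[q qp <-]]; [left|right; exists q => //; left].
set B := base d p.1 in BD *; set c := e B p.2.
have [iso|niso] := pselect (isolated lam (tp B [tuple c])); last first.
  (* The listed type is not isolated, so nothing has to be realized and any point with an isolated
     type over the stage is taken. *)
  have [||z [_ z1 z2 z3]] := @extend_type (stage d p) set0 Dn.
  - by apply: inj_le_lt_trans nl; exists (fun=> 0) => x; case: (set_valP x).
  - by exists c.
  by exists z.
have /isolatedP[R0 [R0l cR0 R0P]] := iso.
pose u (b : B) : stage d p := toset (BD _ (set_valP b)).
have uE f z : sat (rename (omap u) f) (oapp val z) <-> sat f (oapp (fun b : B => val b) z).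
  by rewrite sat_rename; apply: sat_agree => -[].
have [||z [zr z1 z2 z3]] := @extend_type (stage d p) (rename (omap u) @` R0) Dn.
- by apply: inj_le_lt_trans R0l; apply/inj_leP/card_image_le.
- by exists c => _ [f /cR0 fc <-]; apply/uE.
exists z; split=> // _; apply: R0P => f Rf; apply/uE; apply: zr.
by exists f.
Qed.

Let nR : inj_lt nat R.
Proof. by have [_ /inj_leT lR _] := hR; exact: inj_lt_le_trans nl lR. Qed.

Section Model.
Variable d : Idx -> C.
Hypothesis dgood : forall p, good d p.
Let M : set C := A `|` range d.

Let M_nice : nice M. Proof. by apply: nice_down. Qed.

Let base_nice i : nice (base d i).
Proof.
apply: nice_down => // p q [pq|[pq _]] /= qi; first exact: wo_trans pq qi.
by rewrite pq.
Qed.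

(* [R] is at most the successor of [lam], so its initial segments embed in [lam]. *)
Let base_X i : inj_le (base d i) X.
Proof.
apply: inj_le_trans (inj_le_setU _ _) _; apply: inj_le_trans (inj_le_sumX nX).
apply: inj_le_sum AX _; apply: (@inj_le_trans (seg ltR i * X)).
  apply: (inj_le_surj (f := fun p => d (val p.1, p.2))) => _ [p pi <-].
  by exists (toset (pi : seg ltR i p.1), p.2); rewrite /= -surjective_pairing.
apply: inj_le_trans (inj_le_square nX); apply: inj_le_prod (inj_lexx _).
apply: inj_le_trans lamX; apply: is_reg_lt (inj_ltW nl) hR _; exact: segR.
Qed.

(** Fewer than [lam] parameters lie in a single base, since [R] is regular and at least [lam]. Over
    this base the type extends to an isolated one, which is enumerated and therefore realized at
    that level of the chain. *)
Let M_realizes (Q : Type) (v : Q -> M) (S : set (formula L (option Q))) :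
  inj_lt Q lam -> (exists x, forall f, S f -> sat f (oapp (fun q => val (v q)) x)) ->
  exists b : M, forall f, S f -> sat f (oapp (fun q => val (v q)) (val b)).
Proof.
move=> Ql [x xS]; have [Rreg /inj_leT lR _] := hR; have [r0 _] := inj_ltW nR.
(* A point added at level [i] is only sure to belong to the bases of strictly later levels. *)
have bound q : exists i, forall i', ltR i i' -> base d i' (val (v q)).
  have [Aq|[p _ pq]] := set_valP (v q); first by exists (r0 0) => i' _; left.
  by exists p.1 => i' pi; right; exists p.
have [rho rhoP] := choice bound.
have [i iP] : exists i, forall j, (range rho) j -> ltR j i.
  apply: regular_bounded => //.
  by apply: inj_le_lt_trans (inj_le_range rho) _; apply: inj_lt_le_trans Ql lR.
have vi q : base d i (val (v q)) by apply: (rhoP q); apply: iP; exists q.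
pose u q : base d i := toset (vi q).
have uE f z : sat (rename (omap u) f) (oapp val z) <-> sat f (oapp (fun q => val (v q)) z).
  by rewrite sat_rename; apply: sat_agree => -[].
have [||c [cS ciso cc cP]] := @extend_type (base d i) (rename (omap u) @` S) (base_nice i).
- apply: (@inj_le_lt_trans S); first exact/inj_leP/card_image_le.
  apply: (@inj_le_lt_trans (formula L (option Q))); first exact: inj_le_set.
  by apply: inj_lt_formula => //; [exact: None|exact: inj_lt_option].
- by exists x => _ [f /xS fx <-]; apply/uE.
have [y yE] := eP (base_nice i) (base_X i) cc cP.
have [_ _ _ /=] := dgood (i, y); rewrite yE => /(_ ciso) dE.
exists (toset (or_intror (ex_intro2 _ _ (i, y) I erefl) : M (d (i, y)))) => f Sf /=.
apply/uE; have /tp_eqP := esym dE; apply; apply: cS.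
by exists f.
Qed.

Let m0 : M := toset (or_introl (set_valP a0) : M (val a0)).

Let M_sat Y (f : formula L Y) (rho : Y -> M) :
  sat (M := substructure M) f rho <-> sat f (fun y => val (rho y)).
Proof.
apply: (Tarski_Vaught m0) => g v x gx.
by have [|b bP] := @M_realizes nat v [set g] nl; [exists x => _ ->|exists b; apply: bP].
Qed.

Let M_elem : elem_sub M [set: C].
Proof.
split=> // n f x y xy; rewrite M_sat.
have TV Y (g : formula L Y) (rho : Y -> [set: C]) :
    sat (M := substructure [set: C]) g rho <-> sat g (fun y => val (rho y)).
  apply: (Tarski_Vaught (toset (I : [set: C] (val a0)))) => h v z hz.
  by exists (toset (I : [set: C] z)).
by rewrite TV; apply: sat_agree => i _; exact: xy.
Qed.

Let M_saturated : saturated lam (substructure M).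
Proof.
suff h : saturated1 lam (substructure M) by exact: saturated_n nl h m0.
move=> Q v Ql S Sfin.
have vE (f : formula L (option Q)) (b : M) : sat (M := substructure M) f (oapp v b) <->
    sat f (oapp (fun q => val (v q)) (val b)).
  by rewrite M_sat; apply: sat_agree => -[].
have Qk : inj_lt Q kappa.
  by apply: inj_lt_le_trans Ql _; exact: inj_le_trans lamX (inj_ltW Xk).
have [|x xS] := @Csat Q (fun q => val (v q)) Qk S.
  by move=> s sS; have [b bs] := Sfin s sS; exists (val b) => f /bs/vE.
have [|b bS] := @M_realizes Q v S Ql; first by exists x.
by exists b => f /bS; move/vE.
Qed.

Let M_size : inj_le M (X + R).
Proof.
have nXR : inj_le nat (X + R).
  by apply: inj_le_trans nX _; exists inl => a b [].
have XR : inj_le X (X + R) by exists inl => a b [].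
apply: inj_le_trans (inj_le_setU _ _) _; apply: inj_le_trans (inj_le_sumX nXR).
apply: inj_le_sum; first exact: inj_le_trans AX XR.
apply: inj_le_trans (inj_le_range d) _; apply: inj_le_trans (inj_le_square nXR).
by apply: inj_le_prod XR; exists inr => a b [].
Qed.

Lemma chain_model : exists M : set C,
  [/\ submodel kappa M, saturated lam (substructure M),
      A `<=` M /\ M `&` Pset P C = A `&` Pset P C,
      M #<= [set: ((formula L nat -> A) + R)%type] &
      constructible P lam A M].
Proof.
have [Mk Mc MN] := M_nice; have [_ _ AN] := An.
have MA : M `&` Pset P C = A `&` Pset P C by rewrite MN AN.
exists M; split=> //.
- by split; [exact/card_ltTl|exact: M_elem].
- by split=> // x; left.
- exact/inj_leTl.
split; [by rewrite MA => x []|by move=> x; left|].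
exists Idx, (fun p q => `[< lt p q \/ p = q >]), d; split=> //.
  exact: wo_well_order.
move=> p; rewrite (_ : [set j | _] = seg lt p); first by have [] := dgood p.
apply/seteqP; split=> q /=.
  by move=> [/asboolP[]].
by move=> qp; split; [apply/asboolP; left|move=> E; rewrite E in qp; exact: wo_irr ltwo _ qp].
Qed.

End Model.
End Chain.

Lemma primary_model : exists M : set C,
  [/\ submodel kappa M, saturated lam (substructure M),
      A `<=` M /\ M `&` Pset P C = A `&` Pset P C,
      M #<= [set: ((formula L nat -> A) + R)%type] &
      constructible P lam A M].
Proof.
have [ltR [ltRwo segR]] := initial_wo R.
have [ltX ltXwo] := well_orderable X.
have [e eP] := enumerations.
have [d dgood] := chain_exists e ltRwo ltXwo.
exact: chain_model ltRwo segR ltXwo eP d dgood.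
Qed.

End Construction.

Theorem theorem6p6 (L : language) (P : rel_symbol L 1) (T : set (sentence L))
    (kappa : cardinal) (C : structure L)
    (hT : complete_theory T) (hC : monster kappa T C)
    (hP : standing_assumptions P T C)
    (lam : cardinal) (hlam : card_T L #< [set: lam])
    (N : set C) (hN : submodel_P kappa P N)
    (hNcompact : compact_struct lam (substructure N))
    (hstable : fully_stable kappa P N) :
  full_existence kappa P lam N /\
  forall A : set C, small kappa A -> complete_set P A -> A `&` Pset P C = N ->
  forall reg_lam : cardinal, is_reg lam reg_lam ->
  exists M : set C,
    [/\ submodel kappa M,
        saturated lam (substructure M),
        A `<=` M /\ M `&` Pset P C = A `&` Pset P C,
        M #<= [set: ((formula L nat -> A) + reg_lam)%type] &
        constructible P lam A M].
Proof.
have Kl : inj_lt (formula L nat) lam by exact/card_ltT.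
have An (A : set C) : small kappa A -> complete_set P A -> A `&` Pset P C = N ->
    nice P kappa N A.
  by move=> As Ac AN; split=> //; apply/card_ltTl.
split=> A As Ac AN; last first.
  move=> R; apply: (primary_model hC hP Kl hN hNcompact hstable); exact: An.
have [R hR] := is_reg_exists (inj_le_trans (inj_le_formula_nat L) (inj_ltW Kl)).
have [|M [Mk Msat [AM MP] _ _]] :=
  primary_model hC hP Kl hN hNcompact hstable (A := A) _ hR; first exact: An.
by exists M.
Qed.
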